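(* Let $a<b$, $N,r\in\mathbb{N}$, $\alpha,\beta\in(0,1)$, $\gamma\in[0,1]$, $L,G^1,\ldots,G^r\in C^1([a,b]\times\mathbb{R}^{3N};\mathbb{R})$, $\mathbf{y}^a,\mathbf{y}^b\in\mathbb{R}^N$, and $\xi_1,\ldots,\xi_r\in\mathbb{R}$. Consider the isoperimetric problem of minimizing $$\mathcal{J}(y)=\int_a^b L[y]^{\alpha,\beta}_{\gamma}(x)\,dx$$ over all $y\in\mathbf{D}$ subject to the boundary conditions $y(a)=\mathbf{y}^a$, $y(b)=\mathbf{y}^b$ and the $r$ isoperimetric constraints $$\mathcal{G}^j(y)=\int_a^b G^j[y]^{\alpha,\beta}_{\gamma}(x)\,dx=\xi_j,\qquad j=1,\ldots,r.$$ Let $y$ be a local minimizer to this problem. Assume that $\mathcal{J},\mathcal{G}^1,\ldots,\mathcal{G}^r$ are defined in a neighborhood of $y$ and have continuous first variations in this neighborhood, and that there are functions $\mathbf{h}^1,\ldots,\mathbf{h}^r\in\mathbf{D}$ such that the matrix $A=(a_{kl})$, $a_{kl}:=\delta\mathcal{G}^k(y;\mathbf{h}^l)$, has maximal rank $r$. Then there exist constants $\lambda_1,\ldots,\lambda_r\in\mathbb{R}$ such that, with $$F(x,u,v,w,\lambda_1,\ldots,\lambda_r):=L(x,u,v,w)-\sum_{j=1}^r\lambda_jG^j(x,u,v,w),\qquad x\in[a,b],\ u,v,w\in\mathbb{R}^N,$$ $y$ satisfies the system of $N$ fractional Euler--Lagrange equations $$\partial_iF\,{}_{\lambda}\{y\}^{\alpha,\beta}_{\gamma}(x)-\frac{d}{dx}\partial_{N+i}F\,{}_{\lambda}\{y\}^{\alpha,\beta}_{\gamma}(x)+D^{\beta,\alpha}_{1-\gamma}\,\partial_{2N+i}F\,{}_{\lambda}\{y\}^{\alpha,\beta}_{\gamma}(x)=0,\qquad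 i=2,\ldots,N+1,$$ for all $x\in[a,b]$.
   Context: Fractional integrals: for $f\in L_1([a,b])$ and $0<\mu<1$, ${}_aI_x^{\mu}f(x)=\frac{1}{\Gamma(\mu)}\int_a^x(x-t)^{\mu-1}f(t)\,dt$ and ${}_xI_b^{\mu}f(x)=\frac{1}{\Gamma(\mu)}\int_x^b(t-x)^{\mu-1}f(t)\,dt$ (left and right Riemann--Liouville integrals). Riemann--Liouville derivatives: ${}_aD_x^{\mu}f(x)=\frac{d}{dx}\,{}_aI_x^{1-\mu}f(x)$ and ${}_xD_b^{\mu}f(x)=-\frac{d}{dx}\,{}_xI_b^{1-\mu}f(x)$. Caputo derivatives, for $f$ absolutely continuous on $[a,b]$: ${}^C_aD_x^{\mu}f(x)={}_aI_x^{1-\mu}(f')(x)$ and ${}^C_xD_b^{\mu}f(x)={}_xI_b^{1-\mu}(-f')(x)$. Combined derivatives: ${}^{C}D^{\alpha,\beta}_{\gamma}=\gamma\,{}^C_aD_x^{\alpha}+(1-\gamma)\,{}^C_xD_b^{\beta}$, applied componentwise to vector functions, and $D^{\beta,\alpha}_{1-\gamma}=(1-\gamma)\,{}_aD_x^{\beta}+\gamma\,{}_xD_b^{\alpha}$. $\mathbf{D}$ is the set of all functions $y:[a,b]\to\mathbb{R}^N$ such that $y'$ and ${}^{C}D^{\alpha,\beta}_{\gamma}y$ exist and are continuous on $[a,b]$, with norm $\|y\|_{1,\infty}=\max_{[a,b]}\|y(x)\|+\max_{[a,b]}\|y'(x)\|+\max_{[a,b]}\|{}^{C}D^{\alpha,\beta}_{\gamma}y(x)\|$,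 where $\|\cdot\|$ is a norm on $\mathbb{R}^N$. Neighborhoods are with respect to this norm. A function in $\mathbf{D}$ satisfying all constraints of the problem is called admissible; $\mathcal{D}$ is the set of admissible functions. A function $\overline{y}\in\mathcal{D}$ is a local minimizer if there is $\delta>0$ such that $\mathcal{J}(\overline{y})\le\mathcal{J}(y)$ for all $y\in\mathcal{D}$ with $\|y-\overline{y}\|_{1,\infty}<\delta$. First variation of a functional $\mathcal{K}$ at $y\in\mathbf{D}$ in the direction $\mathbf{h}\in\mathbf{D}$: $\delta\mathcal{K}(y;\mathbf{h})=\lim_{\epsilon\to0}\frac{\mathcal{K}(y+\epsilon\mathbf{h})-\mathcal{K}(y)}{\epsilon}$, provided the limit exists. Notation: $[y]^{\alpha,\beta}_{\gamma}(x)=(x,y(x),y'(x),{}^{C}D^{\alpha,\beta}_{\gamma}y(x))$ and ${}_{\lambda}\{y\}^{\alpha,\beta}_{\gamma}(x)=(x,y(x),y'(x),{}^{C}D^{\alpha,\beta}_{\gamma}y(x),\lambda_1,\ldots,\lambda_r)$; juxtaposing a function with one of these symbols means evaluating the function at that point. $\partial_iF$ is the partial derivative of $F$ with respect to its $i$-th scalar argument (the first argument being $x$), so that for $i=2,\dots,N+1$ the derivatives $\partial_i,\partial_{N+i},\partial_{2N+i}$ are with respect to the $(i-1)$-th components of $y$, $y'$ and ${}^{C}D^{\alpha,\beta}_{\gamma}y$.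
   Formalization: The functions h^1,…,h^r are also required to vanish at a and b; the Euler–Lagrange equations hold at every x in [a,b] with the differentiated terms collected under one d/dx, and term by term at each x where the separate derivatives (with nonzero coefficient) exist. *)

(* Defs.v *)
(* MathComp-Analysis, over an arbitrary [R : realType]. *)
From HB Require Import structures.
From mathcomp Require Import all_boot all_order all_algebra.
From mathcomp Require Import all_classical all_reals all_analysis.

Set Implicit Arguments.
Unset Strict Implicit.
Unset Printing Implicit Defensive.

Import Order.TTheory GRing.Theory Num.Theory.
Import numFieldNormedType.Exports.

Local Open Scope classical_set_scope.
Local Open Scope ring_scope.

(* A function on [a, b] is represented by a total function on R; everything
   below depends only on its values on [a, b].  In particular d/dx is taken
   relative to [a, b], i.e. it is one-sided at the two endpoints. *)
Definition diff_quot (R : realType) (W : normedModType R)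
    (f : R -> W) (x z : R) : W :=
  (z - x)^-1 *: (f z - f x).

Definition derivable_on (R : realType) (W : normedModType R) (a b : R)
    (f : R -> W) (x : R) : Prop :=
  cvg (diff_quot f x @ within `[a, b] x^').

Definition derive_on (R : realType) (W : normedModType R) (a b : R)
    (f : R -> W) (x : R) : W :=
  lim (diff_quot f x @ within `[a, b] x^').

Definition is_derive_on (R : realType) (W : normedModType R) (a b : R)
    (f : R -> W) (x : R) (l : W) : Prop :=
  diff_quot f x @ within `[a, b] x^' --> l.

Definition Gamma (R : realType) (mu : R) : R :=
  \int[lebesgue_measure]_(t in `]0, +oo[) (t `^ (mu - 1) * expR (- t)).

Definition RLI_left (R : realType) (a mu : R) (f : R -> R) (x : R) : R :=
  (Gamma mu)^-1 *
    \int[lebesgue_measure]_(t in `[a, x]) ((x - t) `^ (mu - 1) * f t).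

Definition RLI_right (R : realType) (b mu : R) (f : R -> R) (x : R) : R :=
  (Gamma mu)^-1 *
    \int[lebesgue_measure]_(t in `[x, b]) ((t - x) `^ (mu - 1) * f t).

Definition RLI_left_exists (R : realType) (a mu : R) (f : R -> R) (x : R) :=
  lebesgue_measure.-integrable `[a, x]
    (EFin \o (fun t => (x - t) `^ (mu - 1) * f t)).

Definition RLI_right_exists (R : realType) (b mu : R) (f : R -> R) (x : R) :=
  lebesgue_measure.-integrable `[x, b]
    (EFin \o (fun t => (t - x) `^ (mu - 1) * f t)).

Definition RLD_left (R : realType) (a b mu : R) (f : R -> R) (x : R) : R :=
  derive_on a b (RLI_left a (1 - mu) f) x.

Definition RLD_right (R : realType) (a b mu : R) (f : R -> R) (x : R) : R :=
  - derive_on a b (RLI_right b (1 - mu) f) x.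

(* D^{mu,nu}_g = g aD_x^mu + (1 - g) xD_b^nu *)
Definition RLD_comb (R : realType) (a b mu nu g : R) (f : R -> R) (x : R) : R :=
  g * RLD_left a b mu f x + (1 - g) * RLD_right a b nu f x.

Definition caputo_left (R : realType) (a b mu : R) (f : R -> R) (x : R) : R :=
  RLI_left a (1 - mu) (derive_on a b f) x.

Definition caputo_right (R : realType) (a b mu : R) (f : R -> R) (x : R) : R :=
  RLI_right b (1 - mu) (fun t => - derive_on a b f t) x.

Definition caputo_comb (R : realType) (a b alpha beta gamma : R) (N : nat)
    (y : R -> 'rV[R]_N) (x : R) : 'rV[R]_N :=
  \row_(k < N) (gamma * caputo_left a b alpha (fun t => y t 0 k) x +
                (1 - gamma) * caputo_right a b beta (fun t => y t 0 k) x).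

Definition caputo_exists (R : realType) (a b alpha beta : R) (N : nat)
    (y : R -> 'rV[R]_N) (x : R) : Prop :=
  forall k : 'I_N,
    RLI_left_exists a (1 - alpha) (derive_on a b (fun t => y t 0 k)) x /\
    RLI_right_exists b (1 - beta)
      (fun t => - derive_on a b (fun s => y s 0 k) t) x.

Definition in_D (R : realType) (a b alpha beta gamma : R) (N : nat)
    (y : R -> 'rV[R]_N) : Prop :=
  [/\ forall x, x \in `[a, b] -> derivable_on a b y x,
      {within `[a, b], continuous (derive_on a b y)},
      forall x, x \in `[a, b] -> caputo_exists a b alpha beta y x &
      {within `[a, b], continuous (caputo_comb a b alpha beta gamma y)}].

Definition is_norm (R : realType) (N : nat) (nrm : 'rV[R]_N -> R) : Prop :=
  [/\ forall u, 0 <= nrm u,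
      forall u, nrm u = 0 -> u = 0,
      forall (c : R) u, nrm (c *: u) = `|c| * nrm u &
      forall u v, nrm (u + v) <= nrm u + nrm v].

Definition max_norm_on (R : realType) (a b : R) (N : nat)
    (nrm : 'rV[R]_N -> R) (f : R -> 'rV[R]_N) : R :=
  sup [set nrm (f x) | x in `[a, b]].

Definition norm1inf (R : realType) (a b alpha beta gamma : R) (N : nat)
    (nrm : 'rV[R]_N -> R) (y : R -> 'rV[R]_N) : R :=
  max_norm_on a b nrm y + max_norm_on a b nrm (derive_on a b y) +
  max_norm_on a b nrm (caputo_comb a b alpha beta gamma y).

(* Functions of (x, u, v, w) in [a, b] x R^N x R^N x R^N. *)
Definition lagrangian (R : realType) (N : nat) : Type :=
  R -> 'rV[R]_N -> 'rV[R]_N -> 'rV[R]_N -> R.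

Definition partial_x (R : realType) (a b : R) (N : nat) (L : lagrangian R N) :
    lagrangian R N :=
  fun x u v w => derive_on a b (fun s => L s u v w) x.

(* For k : 'I_N (counted from 0), the next three are the derivatives with
   respect to the scalar arguments number i, N + i and 2N + i, where
   i = k + 2. *)
Definition partial_u (R : realType) (N : nat) (k : 'I_N) (L : lagrangian R N) :
    lagrangian R N :=
  fun x u v w => 'D_(delta_mx 0 k) (fun u' => L x u' v w) u.

Definition partial_v (R : realType) (N : nat) (k : 'I_N) (L : lagrangian R N) :
    lagrangian R N :=
  fun x u v w => 'D_(delta_mx 0 k) (fun v' => L x u v' w) v.

Definition partial_w (R : realType) (N : nat) (k : 'I_N) (L : lagrangian R N) :
    lagrangian R N :=
  fun x u v w => 'D_(delta_mx 0 k) (fun w' => L x u v w') w.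

Definition continuous_lagrangian (R : realType) (a b : R) (N : nat)
    (L : lagrangian R N) : Prop :=
  {within [set p : R * 'rV[R]_N * 'rV[R]_N * 'rV[R]_N |
             p.1.1.1 \in `[a, b]],
   continuous (fun p : R * 'rV[R]_N * 'rV[R]_N * 'rV[R]_N =>
                 L p.1.1.1 p.1.1.2 p.1.2 p.2)}.

Definition partials_exist (R : realType) (a b : R) (N : nat)
    (L : lagrangian R N) : Prop :=
  forall x u v w, x \in `[a, b] ->
    derivable_on a b (fun s => L s u v w) x /\
    forall k : 'I_N,
      [/\ derivable (fun u' => L x u' v w) u (delta_mx 0 k),
          derivable (fun v' => L x u v' w) v (delta_mx 0 k) &
          derivable (fun w' => L x u v w') w (delta_mx 0 k)].

Definition C1_lagrangian (R : realType) (a b : R) (N : nat)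
    (L : lagrangian R N) : Prop :=
  [/\ continuous_lagrangian a b L,
      partials_exist a b L,
      continuous_lagrangian a b (partial_x a b L) &
      forall k : 'I_N, [/\ continuous_lagrangian a b (partial_u k L),
                           continuous_lagrangian a b (partial_v k L) &
                           continuous_lagrangian a b (partial_w k L)]].

(* L[y](x) = L(x, y(x), y'(x), (CD y)(x)) *)
Definition along (R : realType) (a b alpha beta gamma : R) (N : nat)
    (L : lagrangian R N) (y : R -> 'rV[R]_N) (x : R) : R :=
  L x (y x) (derive_on a b y x) (caputo_comb a b alpha beta gamma y x).

Definition functional (R : realType) (a b alpha beta gamma : R) (N : nat)
    (L : lagrangian R N) (y : R -> 'rV[R]_N) : R :=
  \int[lebesgue_measure]_(x in `[a, b]) along a b alpha beta gamma L y x.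

Definition functional_defined (R : realType) (a b alpha beta gamma : R)
    (N : nat) (L : lagrangian R N) (y : R -> 'rV[R]_N) : Prop :=
  lebesgue_measure.-integrable `[a, b]
    (EFin \o along a b alpha beta gamma L y).

Definition variation_quot (R : realType) (N : nat)
    (K : (R -> 'rV[R]_N) -> R) (y h : R -> 'rV[R]_N) (e : R) : R :=
  (K (fun x => y x + e *: h x) - K y) / e.

Definition has_first_variation (R : realType) (N : nat)
    (K : (R -> 'rV[R]_N) -> R) (y h : R -> 'rV[R]_N) : Prop :=
  cvg (variation_quot K y h @ 0^').

Definition first_variation (R : realType) (N : nat)
    (K : (R -> 'rV[R]_N) -> R) (y h : R -> 'rV[R]_N) : R :=
  lim (variation_quot K y h @ 0^').

(* The functional of L is defined near y and, for each fixed direction h,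
   z |-> delta K(z; h) exists and is continuous near y. *)
Definition continuous_variations_near (R : realType)
    (a b alpha beta gamma : R) (N : nat) (nrm : 'rV[R]_N -> R)
    (L : lagrangian R N) (y : R -> 'rV[R]_N) : Prop :=
  let D := in_D a b alpha beta gamma (N := N) in
  let norm := norm1inf a b alpha beta gamma nrm in
  let K := functional a b alpha beta gamma L in
  let U rho z := D z /\ norm (fun x => z x - y x) < rho in
  exists2 rho : R, 0 < rho &
    forall z, U rho z ->
      functional_defined a b alpha beta gamma L z /\
      forall h, D h ->
        has_first_variation K z h /\
        forall eps : R, 0 < eps ->
          exists2 eta : R, 0 < eta &
            forall z', U rho z' -> norm (fun x => z' x - z x) < eta ->
              `|first_variation K z' h - first_variation K z h| < eps.

Definition admissible (R : realType) (a b alpha beta gamma : R) (N r : nat)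
    (G : 'I_r -> lagrangian R N) (ya yb : 'rV[R]_N) (xi : 'I_r -> R)
    (y : R -> 'rV[R]_N) : Prop :=
  [/\ in_D a b alpha beta gamma y, y a = ya, y b = yb &
      forall j, functional a b alpha beta gamma (G j) y = xi j].

Definition local_minimizer (R : realType) (a b alpha beta gamma : R)
    (N r : nat) (nrm : 'rV[R]_N -> R) (L : lagrangian R N)
    (G : 'I_r -> lagrangian R N) (ya yb : 'rV[R]_N) (xi : 'I_r -> R)
    (y : R -> 'rV[R]_N) : Prop :=
  admissible a b alpha beta gamma G ya yb xi y /\
  exists2 delta : R, 0 < delta &
    forall z, admissible a b alpha beta gamma G ya yb xi z ->
      norm1inf a b alpha beta gamma nrm (fun x => z x - y x) < delta ->
      functional a b alpha beta gamma L y <=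
      functional a b alpha beta gamma L z.

(* Directions that preserve the boundary conditions.  The rank condition on
   the constraints has to be tested on these: with r = N = 1,
   G = sqrt (1 + v^2) and xi the length of the chord, the chord (of nonzero
   slope) is the only admissible function, delta G(y; h) is a nonzero multiple
   of h b - h a, and the Euler-Lagrange equation fails for L = u. *)
Definition admissible_direction (R : realType) (a b alpha beta gamma : R)
    (N : nat) (h : R -> 'rV[R]_N) : Prop :=
  [/\ in_D a b alpha beta gamma h, h a = 0 & h b = 0].

Definition augmented (R : realType) (N r : nat) (L : lagrangian R N)
    (G : 'I_r -> lagrangian R N) (lam : 'I_r -> R) : lagrangian R N :=
  fun x u v w => L x u v w - \sum_(j < r) lam j * G j x u v w.

(* The function under d/dx when the derivatives in the Euler-Lagrange equation
     d_uF - d/dx d_vF + (1 - gamma) d/dx aI_x^{1 - beta} d_wF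
                      - gamma d/dx xI_b^{1 - alpha} d_wF = 0
   are collected. *)
Definition EL_momentum (R : realType) (a b alpha beta gamma : R) (N : nat)
    (F : lagrangian R N) (y : R -> 'rV[R]_N) (k : 'I_N) (x : R) : R :=
  along a b alpha beta gamma (partial_v k F) y x
  - (1 - gamma) *
      RLI_left a (1 - beta) (along a b alpha beta gamma (partial_w k F) y) x
  + gamma *
      RLI_right b (1 - alpha) (along a b alpha beta gamma (partial_w k F) y) x.

(* A derivative with coefficient 0 is not required to exist. *)
Definition EL_terms_exist (R : realType) (a b alpha beta gamma : R) (N : nat)
    (F : lagrangian R N) (y : R -> 'rV[R]_N) (k : 'I_N) (x : R) : Prop :=
  let q := along a b alpha beta gamma (partial_w k F) y in
  [/\ derivable_on a b (along a b alpha beta gamma (partial_v k F) y) x,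
      gamma != 1 -> derivable_on a b (RLI_left a (1 - beta) q) x &
      gamma != 0 -> derivable_on a b (RLI_right b (1 - alpha) q) x].

Definition EL_expr (R : realType) (a b alpha beta gamma : R) (N : nat)
    (F : lagrangian R N) (y : R -> 'rV[R]_N) (k : 'I_N) (x : R) : R :=
  along a b alpha beta gamma (partial_u k F) y x
  - derive_on a b (along a b alpha beta gamma (partial_v k F) y) x
  + RLD_comb a b beta alpha (1 - gamma)
      (along a b alpha beta gamma (partial_w k F) y) x.

(* For a minimizer y that is only in D, the derivatives in the Euler-Lagrange
   equation need not exist one by one: for N = 1, gamma = 0 and
   L = v^2 / 2 + w, the minimizer has y' = (x - a)^(1 - beta) / Gamma (2 - beta)
   + const, so that both d/dx d_vF and aD_x^beta d_wF are infinite at x = a.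
   The equation is therefore understood as follows: the derivative of the
   collected expression always exists and satisfies the equation, and wherever
   the separate derivatives exist the equation holds term by term. *)
Definition EL_equation (R : realType) (a b alpha beta gamma : R) (N : nat)
    (F : lagrangian R N) (y : R -> 'rV[R]_N) (k : 'I_N) (x : R) : Prop :=
  is_derive_on a b (EL_momentum a b alpha beta gamma F y k) x
    (along a b alpha beta gamma (partial_u k F) y x) /\
  (EL_terms_exist a b alpha beta gamma F y k x ->
   EL_expr a b alpha beta gamma F y k x = 0).

(* Main.v *)
(* On a finite-dimensional family y + t g + sum_l c_l h^l, the functionals J and
   G^j are strictly differentiable at the origin, because the Lagrangians are C^1
   and the curve x |-> (y, y', D y)(x) is compact. Choosing the h^l dual to the
   differentials of the constraints, a contraction fixed point solves
   G^j = xi_j for c in terms of t, with c = o(t) whenever the variations of the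
   G^j in the direction g vanish. Minimality of y then forces the variation of J
   in the direction g to vanish as well, which yields the multipliers, for which
   delta F (y; g) = 0 for every g in D vanishing at a and b.
   Fubini's theorem makes the left and right fractional integrals adjoint to each
   other. Testing with g = (primitive of phi) e_k, where phi is continuous of mean
   zero, the du Bois-Reymond lemma shows that the momentum
   d_v F + (adjoint of D) (d_w F) has derivative d_u F, which is the
   Euler-Lagrange equation. *)

Require Import Defs.
From HB Require Import structures.
From mathcomp Require Import all_boot all_order all_algebra.
From mathcomp Require Import all_classical all_reals all_analysis.
From mathcomp Require Import measurable_realfun ring lra.
Set Implicit Arguments.
Unset Strict Implicit.
Unset Printing Implicit Defensive.
Import Order.TTheory GRing.Theory Num.Theory.
Import numFieldNormedType.Exports.
Local Open Scope classical_set_scope.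
Local Open Scope ring_scope.

(** * The Riemann-Liouville kernel *)

(** The kernel is singular on the diagonal, so continuity alone gives nothing: everything rests on
    the exact value (x - c)^mu / mu of its integral. That value bounds the inner integral in
    Fubini's theorem and yields a Hoelder estimate of exponent mu for the convolutions. By this
    estimate a C^1 function has a continuous Caputo derivative, so a primitive of any continuous
    function is a legitimate test direction. Strict differentiability is demanded because the
    fixed-point map must contract between two arbitrary parameters c and c' at the same t, while a
    derivative at the origin only compares with the origin. The differential is therefore frozen at
    the unperturbed curve while both ends of an increment move. The du Bois-Reymond form is imposed
    by regularity: d_vF and the fractional integrals of d_wF are only known to be continuous, so
    integration by parts must not differentiate them. It is d_uF that gets integrated, and
    derivability of the momentum comes out as a conclusion. *)

(* Extended by 0 to [s <= 0], so that both one-sided integrals become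
   convolutions over the fixed interval [a, b]. *)
Definition rlker (R : realType) (mu s : R) : R :=
  if 0 < s then s `^ (mu - 1) else 0.

Section kernel.
Context {R : realType} (mu : R).
Hypothesis mu0 : 0 < mu.
Local Notation leb := (@lebesgue_measure R).

Lemma rlker_ge0 s : 0 <= rlker mu s.
Proof. by rewrite /rlker; case: ifP => // _; exact: powR_ge0. Qed.

Lemma measurable_rlker : measurable_fun setT (rlker mu).
Proof.
apply: measurable_fun_ifT => //.
exact: (measurable_fun_ltr (measurable_cst _) (@measurable_id _ _ _)).
Qed.

Lemma measurable_rlkerB x : measurable_fun setT (fun t : R => rlker mu (x - t)).
Proof.
apply: (measurableT_comp measurable_rlker) => //.
exact: measurable_funB.
Qed.

Lemma powR_neg_nincr (p s s' : R) : p <= 0 -> 0 < s -> s <= s' ->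
  s' `^ p <= s `^ p.
Proof.
move=> p0 s0 ss'; have s'0 := lt_le_trans s0 ss'.
rewrite -(opprK p) 2!(powRN _ (- p)) lef_pV2 ?posrE ?powR_gt0//.
by apply: ge0_ler_powR; rewrite ?nnegrE ?oppr_ge0// ltW.
Qed.

Lemma rlker_int_proper x c d : c < d -> d < x ->
  (\int[leb]_(t in `[c, d]) (rlker mu (x - t))%:E =
   ((x - c) `^ mu / mu - (x - d) `^ mu / mu)%:E)%E.
Proof.
move=> cd dx.
pose F t := - ((x - t) `^ mu / mu).
have dF t : t < x -> is_derive t 1 F ((x - t) `^ (mu - 1)).
  move=> tx; rewrite /F.
  have xt0 : 0 < x - t by rewrite subr_gt0.
  have H := is_derive1_powR mu xt0.
  have H2 : is_derive t 1 (fun t => x - t) (-1).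
    have := is_deriveB (is_derive_cst x t 1) (is_derive_id t (1 : R)).
    by rewrite sub0r.
  have H3 := @is_derive1_comp _ (fun s => s `^ mu) (fun t => x - t) t _ _ H H2.
  have H4 : is_derive t 1 (fun t => - mu^-1 * (x - t) `^ mu)
      (- mu^-1 * ((mu * (x - t) `^ (mu - 1)) * -1)).
    have := is_deriveZ (- mu^-1) H3; by [].
  suff -> : (fun t0 : R => - ((x - t0) `^ mu / mu)) = (fun t => - mu^-1 * (x - t) `^ mu).
    apply: is_derive_eq; field; exact: lt0r_neq0.
  by apply/funext => u; rewrite mulNr mulrC.
transitivity (\int[leb]_(t in `[c, d]) ((x - t) `^ (mu - 1))%:E)%E.
  apply: eq_integral => t; rewrite inE/= in_itv/= => /andP[_ td].
  by rewrite /rlker subr_gt0 (le_lt_trans td dx).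
have cF t : t < x -> {for t, continuous F}.
  by move=> /dF [d1 _]; apply: differentiable_continuous; exact/derivable1_diffP.
rewrite (@continuous_FTC2 _ _ F)//.
- by rewrite -EFinB /F opprK addrC.
- apply: continuous_in_subspaceT => t; rewrite inE/= in_itv/= => /andP[_ td].
  have tx := le_lt_trans td dx.
  have xt0 : 0 < x - t by rewrite subr_gt0.
  have H := is_derive1_powR (mu-1) xt0.
  apply: (@continuous_comp _ _ _ (fun t => x - t) (fun s => s `^ (mu - 1))).
    by apply: cvgB; [exact: cvg_cst|exact: cvg_id].
  case: H => d1 _; apply: differentiable_continuous; exact/derivable1_diffP.
- have dx' := dx.
  split.
  + by move=> t; rewrite in_itv/= => /andP[_ td]; case: (dF t (lt_trans td dx)).
  + by apply: cvg_at_right_filter; apply: cF; exact: lt_trans cd dx.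
  + by apply: cvg_at_left_filter; exact: cF.
- move=> t; rewrite in_itv/= => /andP[_ td]; rewrite derive1E.
  by case: (dF t (lt_trans td dx)).
Qed.

(** The kernel may blow up at [t = x], so the fundamental theorem only reaches [d < x]. Monotone
    convergence along [d n] increasing to [x] gives the rest, and from [x] on the kernel is 0. *)
Lemma rlker_int x c b : c <= x -> x <= b ->
  (\int[leb]_(t in `[c, b]) (rlker mu (x - t))%:E = ((x - c) `^ mu / mu)%:E)%E.
Proof.
rewrite le_eqVlt => /predU1P[<- xb|cx xb].
  rewrite subrr powR0 ?lt0r_neq0// mul0r.
  apply: integral0_eq => t; rewrite /= in_itv/= => /andP[ct _].
  by rewrite /rlker subr_gt0 ltNge ct.
transitivity (\int[leb]_(t in `[c, x[) (rlker mu (x - t))%:E)%E.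
  rewrite integral_mkcond [RHS]integral_mkcond; apply: eq_integral => t _.
  rewrite !patchE; case: ifPn; case: ifPn; rewrite ?inE /= ?in_itv/= => //.
  + move=> h1 /andP[ct tb]; rewrite /rlker subr_gt0.
    by move: h1; rewrite notin_setE/= in_itv/= ct/= => /negP/negbTE ->.
  + move=> /andP[ct tx]; rewrite notin_setE/= in_itv/= ct/=.
    by rewrite (le_trans (ltW tx) xb).
(* With [n.+2] instead of [n.+1], already [d 0] lies strictly above [c], as [rlker_int_proper]
   demands. *)
pose d n := x - (x - c) / n.+2%:R.
have cd n : c < d n.
  rewrite /d ltrBrDl addrC -ltrBrDl ltr_pdivrMr// ltr_pMr ?subr_gt0//.
  by rewrite ltr1n.
have dx n : d n < x by rewrite /d ltrBlDr ltrDl divr_gt0// subr_gt0.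
have hn : (x - c) / n.+2%:R @[n --> \oo] --> 0.
  rewrite -[X in _ --> X](mulr0 (x - c)); apply: cvgM; first exact: cvg_cst.
  by have := @cvg_harmonic R; rewrite -cvg_shiftS.
pose E n := [set` `[c, d n]].
have nd : nondecreasing_seq E.
  move=> m n mn; rewrite subsetEset => t; rewrite /E /= !in_itv/= => /andP[-> tm]/=.
  apply: (le_trans tm); rewrite /d lerD2l lerN2 ler_wpM2l ?subr_ge0 ?(ltW cx)//.
  by rewrite lef_pV2 ?posrE// ler_nat.
have := @ge0_nondecreasing_set_cvg_integral _ (measurableTypeR R) R E (fun t => (rlker mu (x - t))%:E) (@lebesgue_measure R) nd.
have -> : \bigcup_i E i = `[c, x[%classic.
  apply/seteqP; split => [t [n _]|t].
    rewrite /E/= !in_itv/= => /andP[-> h]/=.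
    exact: le_lt_trans h (dx n).
  rewrite /= in_itv/= => /andP[ct h].
  have /cvgrPdist_lt/(_ (x - t)) := hn.
  rewrite subr_gt0 => /(_ h)[n _ /(_ n (leqnn _))].
  rewrite /= sub0r normrN => /(le_lt_trans (ler_norm _)) xcn.
  exists n => //; rewrite /E /= in_itv/=; apply/andP; split => //.
  by rewrite /d; apply/ltW; rewrite ltrBrDl -ltrBrDr.
move=> /(_ _ _ _)/cvg_lim <- //; first last.
- by move=> i t _; rewrite lee_fin rlker_ge0.
- by move=> i; apply/measurable_EFinP; apply: measurable_funTS; exact: measurable_rlkerB.
- by move=> i; exact: measurable_itv.
apply/cvg_lim => //.
under eq_fun do rewrite rlker_int_proper//.
apply: cvg_EFin; first exact: nearW.
rewrite [X in _ --> X](_ : _ = (x - c) `^ mu / mu - 0 / mu); last by rewrite mul0r subr0.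
apply: cvgB; first exact: cvg_cst.
apply: cvgMl.
have -> : (fun n => (x - d n) `^ mu) = (fun n => ((x - c) / n.+2%:R) `^ mu).
  by apply/funext => n; rewrite /d; congr (_ `^ _); ring.
have := powR_cvg0 mu0.
move/cvg_at_rightP; apply; split.
  by move=> n; rewrite divr_gt0// subr_gt0.
exact: hn.
Qed.

Lemma integrable_rlkerB x c b : c <= x <= b ->
  leb.-integrable `[c, b] (fun t => (rlker mu (x - t))%:E).
Proof.
move=> /andP[cx xb]; apply/integrableP; split.
  by apply/measurable_EFinP; apply: measurable_funTS; exact: measurable_rlkerB.
under eq_integral do rewrite gee0_abs ?lee_fin ?rlker_ge0//.
by rewrite rlker_int// ltry.
Qed.

Lemma Rint_rlker x c b : c <= x <= b ->
  \int[leb]_(t in `[c, b]) rlker mu (x - t) = (x - c) `^ mu / mu.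
Proof. by move=> /andP[cx xb]; rewrite /Rintegral rlker_int. Qed.

End kernel.

Section integrable_EFin.
Context d (T : measurableType d) (R : realType) (m : {measure set T -> \bar R}).
Variables (D : set T) (mD : measurable D).
Implicit Types f g : T -> R.
Local Notation intg f := (m.-integrable D (fun x => (f x)%:E)).

Lemma integrable_EFinD f g : intg f -> intg g -> intg (fun x => f x + g x).
Proof. by move=> fi gi; have := integrableD mD fi gi; apply: eq_integrable. Qed.

Lemma integrable_EFinB f g : intg f -> intg g -> intg (fun x => f x - g x).
Proof. by move=> fi gi; have := integrableB mD fi gi; apply: eq_integrable. Qed.

Lemma integrable_EFinZ c f : intg f -> intg (fun x => c * f x).
Proof. by move=> fi; have := integrableZl mD c fi; apply: eq_integrable. Qed.

Lemma integrable_EFinMl f g : intg f -> measurable_fun D g ->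
  (exists M, forall x, D x -> `|g x| <= M) -> intg (fun x => f x * g x).
Proof.
move=> fi mg [M gM].
have := @integrableMl _ _ _ m D mD (EFin \o f) g fi mg.
have -> : ((EFin \o f) \* (EFin \o g))%E = (fun x => (f x * g x)%:E).
  by apply/funext => x /=; rewrite EFinM.
apply; exists M; split; first exact: num_real.
by move=> N MN t tab; apply: le_trans (ltW MN); exact: gM.
Qed.

End integrable_EFin.

Lemma itv_bounded (R : realType) (V : normedModType R) (a b : R) (f : R -> V) :
  {within `[a, b], continuous f} ->
  exists2 M : R, 0 < M & forall t, t \in `[a, b] -> `|f t| <= M.
Proof.
move=> cf; have [M [_ HM]] := compact_bounded (continuous_compact cf (@segment_compact _ a b)).
exists (`|M| + 1); first by rewrite ltr_wpDl.
move=> t tab; apply: HM; last by exists t.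
by rewrite (le_lt_trans (ler_norm _))// ltrDl.
Qed.

(** * The reflection [t |-> - t], which exchanges left and right integrals *)

Section reflection.
Context {R : realType}.
Local Notation leb := (@lebesgue_measure R).

Lemma ge0_integral_itvN (a b : R) (f : R -> \bar R) :
  measurable_fun `[a, b] f -> (forall t, t \in `[a, b] -> 0 <= f t)%E ->
  (\int[leb]_(t in `[a, b]) f t = \int[leb]_(t in `[(- b)%R, (- a)%R]) f (- t)%R)%E.
Proof.
move=> mf f0.
rewrite (_ : `[- b, - a]%classic = (-%R : _ -> measurableTypeR R) @^-1` `[a, b]); last first.
  by rewrite opp_preimage_itvbndbnd.
rewrite -(@ge0_integral_pushforward _ _ _ (measurableTypeR R) R _ _ leb _ f)//=.
- by apply: eq_measure_integral => A mA _; exact/esym/lebesgue_measureN.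
- by move=> t; rewrite inE => /f0.
Qed.

Lemma integral_itvN (a b : R) (f : R -> \bar R) : measurable_fun `[a, b] f ->
  (\int[leb]_(t in `[a, b]) f t =
   \int[leb]_(t in `[(- b)%R, (- a)%R]) (f \o -%R) t)%E.
Proof.
move=> mf; rewrite integralE [RHS]integralE; congr (_ - _)%E.
- rewrite (ge0_integral_itvN (measurable_funepos mf))//.
  by apply: eq_integral => t _; rewrite [in RHS]funepos_comp.
- rewrite (ge0_integral_itvN (measurable_funeneg mf))//.
  by apply: eq_integral => t _; rewrite [in RHS]funeneg_comp.
Qed.

Lemma Rintegral_itvN (a b : R) (f : R -> R) : measurable_fun `[a, b] f ->
  \int[leb]_(t in `[a, b]) f t = \int[leb]_(t in `[- b, - a]) f (- t).
Proof.
by move=> mf; rewrite /Rintegral integral_itvN//; exact/measurable_EFinP.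
Qed.

Lemma integrable_itvN (a b : R) (f : R -> R) : measurable_fun `[a, b] f ->
  leb.-integrable `[- b, - a] (fun t => (f (- t))%:E) ->
  leb.-integrable `[a, b] (EFin \o f).
Proof.
move=> mf /integrableP[_ foo]; apply/integrableP; split; first exact/measurable_EFinP.
rewrite ge0_integral_itvN//.
by apply/measurable_EFinP; exact: measurableT_comp.
Qed.

End reflection.

(** * Hoelder continuity of convolutions with the kernel *)

Section convolution.
Context {R : realType} (mu a b : R).
Hypothesis mu01 : 0 < mu < 1.
Local Notation leb := (@lebesgue_measure R).

Let mu0 : 0 < mu. Proof. by case/andP: mu01. Qed.

Lemma integrable_rlker_mul (f : R -> R) x : continuous f -> a <= x <= b ->
  leb.-integrable `[a, b] (fun t => (rlker mu (x - t) * f t)%:E).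
Proof.
move=> cf axb.
have [M _ HM] := itv_bounded (@continuous_subspaceT _ _ `[a, b]%classic f cf).
apply: integrable_EFinMl => //; first exact: integrable_rlkerB.
  by apply: measurable_funTS; exact: continuous_measurable_fun.
by exists M.
Qed.

Lemma rlker_nincr s s' : 0 < s -> s <= s' -> rlker mu s' <= rlker mu s.
Proof.
move=> s0 ss'; rewrite /rlker s0 (lt_le_trans s0 ss').
by apply: powR_neg_nincr => //; rewrite subr_le0; case/andP: mu01 => _ /ltW.
Qed.

(** The two kernels differ by at most their own difference left of [x], where the kernel is
    monotone, and by [rlker mu (x' - t)] right of [x]. Both contributions have explicit integrals;
    the terms (x - a)^mu - (x' - a)^mu add up to something nonpositive and are dropped, leaving
    twice (x' - x)^mu / mu. *)
Lemma rlker_holder_lt (f : R -> R) M x x' : continuous f ->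
  (forall t, t \in `[a, b] -> `|f t| <= M) -> 0 <= M ->
  a <= x -> x < x' -> x' <= b ->
  `|\int[leb]_(t in `[a, b]) (rlker mu (x' - t) * f t) -
    \int[leb]_(t in `[a, b]) (rlker mu (x - t) * f t)| <=
  2 * M / mu * (x' - x) `^ mu.
Proof.
move=> cf fM M0 ax xx' x'b.
have x'ab : a <= x' <= b by rewrite x'b (le_trans ax (ltW xx')).
have xab : a <= x <= b by rewrite ax (le_trans (ltW xx') x'b).
have ix := integrable_rlker_mul cf xab.
have ix' := integrable_rlker_mul cf x'ab.
have kx := integrable_rlkerB mu0 xab.
have kx' := integrable_rlkerB mu0 x'ab.
pose g := (fun t => rlker mu (x' - t)) \_ `[x, b].
have setE : `[a, b] `&` `[x, b] = `[x, b]%classic.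
  apply/seteqP; split => t /=; first by case.
  rewrite !in_itv/= => /andP[xt tb]; rewrite xt tb (le_trans ax xt); by [].
have ig : leb.-integrable `[a, b] (EFin \o g).
  rewrite /g -restrict_EFin; apply/integrable_restrict => //.
  rewrite setE; apply: integrable_rlkerB => //; by rewrite x'b (ltW xx').
have intg : \int[leb]_(t in `[a, b]) g t = (x' - x) `^ mu / mu.
  rewrite /g -Rintegral_mkcondr setE Rint_rlker//.
  by rewrite x'b (ltW xx').
rewrite -RintegralB//.
have iB : leb.-integrable `[a, b]
    (EFin \o (fun t => rlker mu (x' - t) * f t - rlker mu (x - t) * f t)).
  exact: integrable_EFinB.
apply: (le_trans (le_normr_Rintegral _ iB)) => //.
(* The absolute value of the kernel difference in one formula: for [t < x] the term [g t] is 0, and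
   for [x <= t] the first kernel is 0, so that [- rlker + 2 * rlker] restores the sign. *)
pose G t := M * (rlker mu (x - t) - rlker mu (x' - t) + 2 * g t).
have i2g : leb.-integrable `[a, b] (fun t => (2 * g t)%:E).
  exact: integrable_EFinZ.
have iD : leb.-integrable `[a, b] (fun t => (rlker mu (x - t) - rlker mu (x' - t))%:E).
  exact: integrable_EFinB.
have iDg : leb.-integrable `[a, b] (fun t => (rlker mu (x - t) - rlker mu (x' - t) + 2 * g t)%:E).
  exact: integrable_EFinD.
have iG : leb.-integrable `[a, b] (EFin \o G).
  exact: integrable_EFinZ.
apply: (@le_trans _ _ (\int[leb]_(t in `[a, b]) G t)).
  apply: le_Rintegral => //.
    exact: integrable_norm.
  move=> t /= tab; rewrite -mulrBl normrM mulrC /G ler_pM//; first exact: fM.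
  rewrite /g patchE; case: ifPn; rewrite ?inE ?notin_setE /= in_itv/=.
    move=> /andP[xt tb].
    have -> : rlker mu (x - t) = 0 by rewrite /rlker subr_gt0 ltNge xt.
    by rewrite subr0 ger0_norm ?rlker_ge0//; lra.
  move=> /negP; rewrite negb_and -!ltNge => /orP[tx|bt]; last first.
    by move: tab; rewrite in_itv/= => /andP[_ /(lt_le_trans bt)]; rewrite ltxx.
  rewrite mulr0 addr0 distrC ger0_norm// subr_ge0; apply: rlker_nincr.
    by rewrite subr_gt0.
  by rewrite lerD2r ltW.
rewrite /G RintegralZl// RintegralD// RintegralB// RintegralZl// intg.
rewrite !Rint_rlker//.
have H : (x - a) `^ mu <= (x' - a) `^ mu.
  by apply: ge0_ler_powR; rewrite ?nnegrE ?subr_ge0 ?lerD2r// ltW// (le_lt_trans ax xx').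
have H2 : (x - a) `^ mu / mu <= (x' - a) `^ mu / mu.
  by rewrite ler_pM2r// invr_gt0.
rewrite [leRHS](_ : _ = M * (2 * ((x' - x) `^ mu / mu))); last by ring.
by rewrite ler_wpM2l//; lra.
Qed.

Lemma rlker_holder (f : R -> R) M x x' : continuous f ->
  (forall t, t \in `[a, b] -> `|f t| <= M) -> 0 <= M ->
  x \in `[a, b] -> x' \in `[a, b] ->
  `|\int[leb]_(t in `[a, b]) (rlker mu (x' - t) * f t) -
    \int[leb]_(t in `[a, b]) (rlker mu (x - t) * f t)| <=
  2 * M / mu * `|x' - x| `^ mu.
Proof.
move=> cf fM M0; rewrite !in_itv/= => /andP[ax xb] /andP[ax' x'b].
have [xx'|x'x|->] := ltgtP x x'.
- by rewrite (gtr0_norm (x := x' - x)) ?subr_gt0//; exact: rlker_holder_lt.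
- rewrite distrC (distrC x') (gtr0_norm (x := x - x')) ?subr_gt0//.
  exact: rlker_holder_lt.
- by rewrite !subrr normr0 !mulr_ge0 ?invr_ge0 ?powR_ge0// ltW.
Qed.

End convolution.

Lemma holder_continuous (R : realType) (mu a b C : R) (f : R -> R) :
  0 < mu -> (forall x x', x \in `[a, b] -> x' \in `[a, b] ->
    `|f x' - f x| <= C * `|x' - x| `^ mu) ->
  {within `[a, b], continuous f}.
Proof.
move=> mu0 hf; apply/subspace_continuousP => x xab.
apply/cvgrPdist_lt => e e0; rewrite /from_subspace.
(* Nothing is assumed on the sign of [C]; [D] is a positive upper bound, and (e / D)^(1 / mu) is the
   radius at which D d^mu reaches [e]. *)
pose D := `|C| + 1; have D0 : 0 < D by rewrite ltr_wpDl.
have d0 : 0 < (e / D) `^ mu^-1 by apply: powR_gt0; exact: divr_gt0.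
rewrite near_withinE; near=> x' => x'ab.
rewrite (le_lt_trans (hf _ _ x'ab xab))//.
have : `|x - x'| `^ mu < e / D; last first.
  rewrite ltr_pdivlMr// mulrC; apply: le_lt_trans; rewrite ler_wpM2r ?powR_ge0//.
  by rewrite (le_trans (ler_norm _))// lerDl.
rewrite -[ltRHS]powRr1 ?divr_ge0 ?ltW// -(@mulVf _ mu) ?lt0r_neq0// powRrM.
apply: gt0_ltr_powR => //; rewrite ?nnegrE ?powR_ge0//.
Unshelve. all: by end_near. Qed.

Lemma continuous_opp_comp (R : realType) (f : R -> R) :
  continuous f -> continuous (f \o -%R).
Proof.
move=> cf t; apply: continuous_comp; last exact: cf.
by apply: cvgN; exact: cvg_id.
Qed.

(** * Reflected kernels and exchange of the order of integration *)

Section convolution_fubini.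
Context {R : realType} (mu a b : R).
Hypothesis mu01 : 0 < mu < 1.
Local Notation leb := (@lebesgue_measure R).

Let mu0 : 0 < mu. Proof. by case/andP: mu01. Qed.

(** Under [t |-> - t] the kernel becomes the one of [integrable_rlker_mul], taken at the point [- x]
    of [- b, - a]. *)
Lemma integrable_rlker_mulN (f : R -> R) x : continuous f -> a <= x <= b ->
  leb.-integrable `[a, b] (fun t => (rlker mu (t - x) * f t)%:E).
Proof.
move=> cf axb; apply: integrable_itvN.
  apply: measurable_funM; last by apply: measurable_funTS; exact: continuous_measurable_fun.
  apply: measurable_funTS; apply: (measurableT_comp (measurable_rlker _)) => //.
  exact: measurable_funB.
have cfN := continuous_opp_comp cf.
have axbN : - b <= - x <= - a by rewrite !lerN2 andbC.
have := integrable_rlker_mul mu01 cfN axbN; apply: eq_integrable => // t _ /=.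
by rewrite (addrC (- t)).
Qed.

Lemma rlker_holderN (f : R -> R) M x x' : continuous f ->
  (forall t, t \in `[a, b] -> `|f t| <= M) -> 0 <= M ->
  x \in `[a, b] -> x' \in `[a, b] ->
  `|\int[leb]_(t in `[a, b]) (rlker mu (t - x') * f t) -
    \int[leb]_(t in `[a, b]) (rlker mu (t - x) * f t)| <=
  2 * M / mu * `|x' - x| `^ mu.
Proof.
move=> cf fM M0 xab x'ab.
have cfN := continuous_opp_comp cf.
have E z : \int[leb]_(t in `[a, b]) (rlker mu (t - z) * f t) =
    \int[leb]_(t in `[- b, - a]) (rlker mu (- z - t) * (f \o -%R) t).
  rewrite Rintegral_itvN; last first.
    apply: measurable_funM; last by apply: measurable_funTS; exact: continuous_measurable_fun.
    apply: measurable_funTS; apply: (measurableT_comp (measurable_rlker _)) => //.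
    exact: measurable_funB.
  by apply: eq_Rintegral => t _ /=; rewrite (addrC (- t)).
rewrite !E (_ : `|x' - x| = `|- x' - (- x)|); last by rewrite -[RHS]normrN; congr (`|_|); ring.
apply: rlker_holder => //.
- move=> t; rewrite in_itv/= => /andP[bt ta]; apply: fM.
  by rewrite in_itv/= lerNr ta lerNl bt.
- by move: xab; rewrite !in_itv/= !lerN2 andbC.
- by move: x'ab; rewrite !in_itv/= !lerN2 andbC.
Qed.

Lemma rlker_continuous (f : R -> R) : continuous f ->
  {within `[a, b], continuous (fun x => \int[leb]_(t in `[a, b]) (rlker mu (x - t) * f t))}.
Proof.
move=> cf.
have [M M0 HM] := itv_bounded (@continuous_subspaceT _ _ `[a, b]%classic f cf).
apply: (@holder_continuous _ mu _ _ (2 * M / mu)) => // x x' xab x'ab.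
exact: rlker_holder (ltW M0) xab x'ab.
Qed.

Lemma rlker_continuousN (f : R -> R) : continuous f ->
  {within `[a, b], continuous (fun x => \int[leb]_(t in `[a, b]) (rlker mu (t - x) * f t))}.
Proof.
move=> cf.
have [M M0 HM] := itv_bounded (@continuous_subspaceT _ _ `[a, b]%classic f cf).
apply: (@holder_continuous _ mu _ _ (2 * M / mu)) => // x x' xab x'ab.
exact: rlker_holderN (ltW M0) xab x'ab.
Qed.

(** The integrand is unbounded near the diagonal, so its integrability on the plane is obtained from
    Tonelli's criterion: the inner integral in [t] is bounded uniformly in [x]. *)
Lemma rlker_fubini (f g : R -> R) : a <= b -> continuous f -> continuous g ->
  \int[leb]_(x in `[a, b]) (f x * \int[leb]_(t in `[a, b]) (rlker mu (x - t) * g t)) =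
  \int[leb]_(t in `[a, b]) (g t * \int[leb]_(x in `[a, b]) (rlker mu (x - t) * f x)).
Proof.
move=> ab cf cg; rewrite /Rintegral; congr fine.
have [M M0 fM] := itv_bounded (@continuous_subspaceT _ _ `[a, b]%classic f cf).
have [N N0 gN] := itv_bounded (@continuous_subspaceT _ _ `[a, b]%classic g cg).
pose D := `[a, b]%classic.
have mD : measurable D by exact: measurable_itv.
(* Cutting [f] and [g] off outside [a, b] turns the square into the whole plane, where Fubini's
   theorem is applied. *)
pose F (p : measurableTypeR R * measurableTypeR R) := (f \_ D) p.1 * rlker mu (p.1 - p.2) * (g \_ D) p.2.
have mfD (h : R -> R) : continuous h -> measurable_fun setT (h \_ D).
  move=> ch; apply: (measurable_restrictT h mD).1; apply: measurable_funTS.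
  exact: continuous_measurable_fun.
have mF : measurable_fun setT F.
  apply: measurable_funM; first apply: measurable_funM.
  - exact: (measurableT_comp (mfD _ cf)).
  - apply: (measurableT_comp (measurable_rlker _)) => //.
    exact: measurable_funB.
  - exact: (measurableT_comp (mfD _ cg)).
have mEF : measurable_fun setT (EFin \o F) by exact/measurable_EFinP.
have iF : (leb \x leb)%E.-integrable setT (EFin \o F).
  apply/(@integrable12ltyP _ _ _ _ R lebesgue_measure lebesgue_measure _ mEF).
  (* The inner integral is at most M N (x - a)^mu / mu, which is largest at [x = b]. *)
  pose C := M * N * ((b - a) `^ mu / mu).
  have C0 : 0 <= C by rewrite !mulr_ge0 ?(ltW M0) ?(ltW N0) ?powR_ge0 ?invr_ge0 ?(ltW mu0).
  apply: (@le_lt_trans _ _ (\int[leb]_x (((cst C%:E) \_ D) x))%E); last first.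
    rewrite -integral_mkcond integral_cst//; apply: lte_mul_pinfty => //.
    by apply: compact_finite_measure; exact: segment_compact.
  apply: ge0_le_integral => //.
  - by move=> x _; apply: integral_ge0 => t _; exact: abse_ge0.
  - by apply: (measurable_fun_fubini_tonelli_F (fun p => `|(EFin \o F) p|)%E) => //; exact: measurableT_comp.
  - by apply: (measurable_restrictT _ mD).1.
  - move=> x _; rewrite patchE; case: ifPn => [|xD]; last first.
      rewrite integral0_eq// => t _.
      by rewrite /F /= patchE (negbTE xD) !mul0r normr0.
    rewrite inE /D /= in_itv/= => xab.
    apply: (@le_trans _ _ (\int[leb]_(t in D) ((M * N)%:E * (rlker mu (x - t))%:E))%E).
      rewrite [leRHS]integral_mkcond; apply: ge0_le_integral => //.
      + apply: (measurableT_comp (f := fun t => `|(EFin \o F) (x, t)|%E)) => //.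
        by apply: measurableT_comp => //; exact: measurableT_comp.
      + apply/(measurable_restrictT _ _).1 => //; apply: emeasurable_funM => //.
        by apply/measurable_EFinP; apply: measurable_funTS; exact: measurable_rlkerB.
      + move=> t _; rewrite /F /= !patchE.
        have -> : x \in D by rewrite inE /D /= in_itv.
        case: ifPn => tD; last by rewrite mulr0 normr0.
        rewrite -EFinM lee_fin !normrM (ger0_norm (rlker_ge0 _ _)).
        rewrite -mulrA (mulrC (rlker _ _)) mulrA ler_wpM2r ?rlker_ge0//.
        by rewrite ler_pM// ?fM ?gN// ?in_itv//; move: tD; rewrite inE /D /= in_itv.
    rewrite ge0_integralZl//; last 3 first.
    + by apply/measurable_EFinP; apply: measurable_funTS; exact: measurable_rlkerB.
    + by move=> t _; rewrite lee_fin rlker_ge0.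
    + by rewrite lee_fin mulr_ge0 ?ltW.
    have /andP[ax xb] := xab.
    rewrite /D rlker_int// -EFinM lee_fin /C ler_wpM2l ?mulr_ge0 ?(ltW M0) ?(ltW N0)//.
    rewrite ler_pM2r ?invr_gt0//; apply: ge0_ler_powR; rewrite ?nnegrE ?subr_ge0 ?lerD2r//.
    exact: ltW.
transitivity (\int[leb]_x \int[leb]_y (EFin \o F) (x, y))%E.
  rewrite integral_mkcond; apply: eq_integral => x _.
  rewrite patchE; case: ifPn => xD; last first.
    by rewrite integral0_eq// => t _; rewrite /F /= patchE (negbTE xD) !mul0r.
  have xab : a <= x <= b by move: xD; rewrite inE /= in_itv.
  have ik := integrable_rlker_mul mu01 cg xab.
  rewrite EFinM fineK ?integrable_fin_num// -integralZl// integral_mkcond.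
  apply: eq_integral => t _; rewrite /F /= !patchE xD; case: ifPn => _; last by rewrite mulr0.
  by rewrite -EFinM mulrA.
rewrite (Fubini iF) [RHS]integral_mkcond; apply: eq_integral => t _.
rewrite patchE; case: ifPn => tD; last first.
  by rewrite integral0_eq// => x _; rewrite /F /= [(g \_ _) _]patchE (negbTE tD) mulr0.
have tab : a <= t <= b by move: tD; rewrite inE /= in_itv.
have ik := integrable_rlker_mulN cf tab.
rewrite EFinM fineK ?integrable_fin_num// -integralZl// integral_mkcond.
apply: eq_integral => x _; rewrite /F /= !patchE tD; case: ifPn => _; last by rewrite !mul0r.
by rewrite -EFinM mulrC (mulrC (f x)).
Qed.

End convolution_fubini.

(** * Derivatives on a segment and the du Bois-Reymond lemma *)

(* [f \o clamp a b] extends a function continuous on [a, b] to a continuous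
   function on the whole line. *)
Definition clamp (R : realType) (a b x : R) : R := Num.max a (Num.min b x).

Section clamp.
Context {R : realType} (a b : R).
Hypothesis ab : a <= b.

Lemma clamp_itv x : clamp a b x \in `[a, b].
Proof. by rewrite in_itv/= /clamp le_max lexx/= ge_max ab/= ge_min lexx. Qed.

Lemma clamp_id x : x \in `[a, b] -> clamp a b x = x.
Proof. by rewrite in_itv/= /clamp => /andP[ax xb]; rewrite (min_idPr xb) (max_idPr ax). Qed.

Lemma continuous_clamp : continuous (clamp a b).
Proof.
move=> x.
apply: (@continuous_max _ _ (cst a) (fun x => Num.min b x)); first exact: cst_continuous.
by apply: (@continuous_min _ _ (cst b) id); [exact: cst_continuous|exact: cvg_id].
Qed.

Lemma continuous_comp_clamp (V : topologicalType) (f : R -> V) :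
  {within `[a, b], continuous f} -> continuous (f \o clamp a b).
Proof.
move=> /subspace_continuousP cf x.
apply: (@cvg_comp _ _ _ (clamp a b) f _ (within `[a, b] (nbhs (clamp a b x)))).
  move=> A wA.
  have cA : \near x, `[a, b]%classic (clamp a b x) -> A (clamp a b x) :=
    continuous_clamp wA.
  change (\forall y \near x, A (clamp a b y)); near=> y; have : clamp a b y \in `[a, b] by exact: clamp_itv.
  by near: y; exact: cA.
by apply: cf; exact: clamp_itv.
Unshelve. all: by end_near. Qed.

End clamp.

Section is_derive_on.
Context {R : realType} (a b : R).
Hypothesis ab : a < b.
Implicit Types V W : normedModType R.

(** Near any point of [a, b] there is another one: to the right if [x < b], to the left if [x = b].
    Properness makes limits unique, so that [derive_on] can be computed from any limit found. *)
Lemma within_dnbhs_proper x : x \in `[a, b] -> ProperFilter (within `[a, b] x^').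
Proof.
rewrite in_itv/= => /andP[ax xb].
apply: Build_ProperFilter => A.
move: A => /nbhs_ballP[e /= e0 eA].
have e20 : 0 < e / 2 by rewrite divr_gt0.
have [xltb|bx] := ltP x b.
  have xz : x < Num.min b (x + e / 2) by rewrite lt_min xltb/= ltrDl.
  have zx : Num.min b (x + e / 2) <= x + e / 2 by rewrite ge_min lexx orbT.
  apply: (eA (Num.min b (x + e / 2))).
  - by rewrite /ball/= ltr0_norm ?subr_lt0// opprB; lra.
  - by rewrite gt_eqF.
  - by rewrite /= in_itv/= ge_min lexx/= andbT (le_trans ax)// ltW.
have xE : x = b by apply/eqP; rewrite eq_le xb bx.
have zx : Num.max a (x - e / 2) < x by rewrite gt_max xE ab/= ltrBlDr ltrDl.
have xz : x - e / 2 <= Num.max a (x - e / 2) by rewrite le_max lexx orbT.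
apply: (eA (Num.max a (x - e / 2))).
- by rewrite /ball/= gtr0_norm ?subr_gt0//; lra.
- by rewrite lt_eqF.
- by rewrite /= in_itv/= le_max lexx/= (le_trans _ xb)// ltW.
Qed.

Lemma is_derive_on_lim V (f : R -> V) x l : x \in `[a, b] ->
  is_derive_on a b f x l -> derive_on a b f x = l.
Proof.
move=> xab fl; apply: cvg_lim => //.
exact: within_dnbhs_proper.
Qed.

Lemma is_derive_on_cvg V (f : R -> V) x l :
  is_derive_on a b f x l -> derivable_on a b f x.
Proof. by move=> fl; apply/cvg_ex; exists l. Qed.

Lemma derivable_on_is_derive V (f : R -> V) x :
  derivable_on a b f x -> is_derive_on a b f x (derive_on a b f x).
Proof. by []. Qed.

Lemma eq_is_derive_on V (f g : R -> V) x l : x \in `[a, b] ->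
  (forall t, t \in `[a, b] -> f t = g t) ->
  is_derive_on a b f x l -> is_derive_on a b g x l.
Proof.
move=> xab fg; apply: cvg_trans; apply: near_eq_cvg.
rewrite near_withinE; near=> t => tab.
by rewrite /diff_quot !fg.
Unshelve. all: by end_near. Qed.

Lemma is_derive_onZD V (f g : R -> V) x l m c :
  is_derive_on a b f x l -> is_derive_on a b g x m ->
  is_derive_on a b (fun t => f t + c *: g t) x (l + c *: m).
Proof.
move=> fl gm.
rewrite /is_derive_on (_ : diff_quot _ x = (fun z => diff_quot f x z + c *: diff_quot g x z)).
  by apply: cvgD => //; exact: cvgZl_tmp.
apply/funext => z; rewrite /diff_quot scalerA mulrC -scalerA -scalerDr; congr (_ *: _).
by rewrite scalerBr opprD addrACA.
Qed.

Lemma is_derive_on_coord N (f : R -> 'rV[R]_N) x l k :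
  is_derive_on a b f x l -> is_derive_on a b (fun t => f t 0 k) x (l 0 k).
Proof.
move=> fl.
rewrite /is_derive_on (_ : diff_quot _ x = (fun M : 'rV[R]_N => M 0 k) \o diff_quot f x).
  exact: (cvg_comp _ _ fl (@coord_continuous _ _ _ 0 k l)).
by apply/funext => z; rewrite /diff_quot /= !mxE.
Qed.

Lemma is_derive_on_scale V (f : R -> R) (v : V) x l :
  is_derive_on a b f x l -> is_derive_on a b (fun t => f t *: v) x (l *: v).
Proof.
move=> fl.
rewrite /is_derive_on (_ : diff_quot _ x = (fun z => diff_quot f x z *: v)).
  exact: cvgZr_tmp.
by apply/funext => z; rewrite /diff_quot -scalerBl scalerA.
Qed.

Lemma is_derive_on_is_derive (f : R -> R) (x l : R) :
  is_derive x (1 : R) f l -> is_derive_on a b f x l.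
Proof.
case=> df fl; have : (fun h => h^-1 *: (f (h *: 1 + x) - f x)) @ 0^' --> l.
  by rewrite -fl.
move=> /cvgrPdist_lt H; apply/cvgrPdist_lt => e /H {}H.
rewrite near_withinE; move: H; rewrite !near_withinE /= => /nbhs_ballP[d /= d0 dH].
apply/nbhs_ballP; exists d => //= z xz zx zab.
have := dH (z - x); rewrite /ball /= sub0r normrN distrC => /(_ xz).
rewrite subr_eq0 => /(_ zx).
by rewrite /diff_quot scaler1 subrK.
Qed.

Lemma is_derive_on_continuous V (f : R -> V) :
  (forall x, x \in `[a, b] -> derivable_on a b f x) ->
  {within `[a, b], continuous f}.
Proof.
move=> df; apply/subspace_continuousP => x xab.
have /cvg_ex[l fl] := df _ xab.
have H : (fun z => f x + (z - x) *: diff_quot f x z) @ within `[a, b] x^' --> f x + (x - x) *: l.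
  apply: cvgD; first exact: cvg_cst.
  apply: cvgZ => //; apply: cvgB; last exact: cvg_cst.
  by apply: cvg_trans; [exact: cvg_within|exact: nbhs_dnbhs].
rewrite subrr scale0r addr0 in H.
apply/cvgrPdist_lt => e e0; have /cvgrPdist_lt/(_ e e0) := H.
rewrite /from_subspace => Hz.
have {}Hz : \forall z \near x, z != x -> `[a, b]%classic z ->
  `|f x - (f x + (z - x) *: diff_quot f x z)| < e by exact: Hz.
rewrite near_withinE; near=> z => zab.
have [->|zx] := eqVneq z x; first by rewrite subrr normr0.
have : `|f x - (f x + (z - x) *: diff_quot f x z)| < e.
  by move: zx zab; near: z; exact: Hz.
rewrite /diff_quot scalerA mulfV ?subr_eq0// scale1r.
by rewrite (addrC (f x) (_ - _)) subrK.
Unshelve. all: by end_near. Qed.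

End is_derive_on.

(* Integrating from [a - 1] makes the derivative at [a] two-sided. *)
Definition primitive (R : realType) (a : R) (f : R -> R) (x : R) : R :=
  \int[lebesgue_measure]_(t in `[a - 1, x]) f t -
  \int[lebesgue_measure]_(t in `[a - 1, a]) f t.

Section primitive.
Context {R : realType} (a : R) (f : R -> R).
Hypothesis cf : continuous f.
Local Notation leb := (@lebesgue_measure R).

Lemma continuous_integrable_itv (g : R -> R) c d : continuous g ->
  leb.-integrable `[c, d] (EFin \o g).
Proof.
move=> cg; apply: continuous_compact_integrable; first exact: segment_compact.
exact: continuous_subspaceT.
Qed.

Lemma primitive_is_derive x : a <= x -> is_derive x (1 : R) (primitive a f) (f x).
Proof.
move=> ax.
have a1x : a - 1 < x by rewrite (lt_le_trans _ ax)// ltrBlDr ltrDl.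
have xx1 : x < x + 1 by rewrite ltrDl.
have [dF F'] := continuous_FTC1_closed xx1 (continuous_integrable_itv _ _ cf) a1x (@cf x).
have H : is_derive x (1 : R) (fun x => \int[leb]_(t in `[a - 1, x]) f t) (f x).
  by split => //; rewrite -derive1E.
rewrite -[X in is_derive _ _ _ X]subr0.
apply: is_deriveB.
Qed.

Lemma primitive_a : primitive a f a = 0. Proof. by rewrite /primitive subrr. Qed.

Lemma primitive_itv x : a <= x -> primitive a f x = \int[leb]_(t in `[a, x]) f t.
Proof.
move=> ax.
have i := continuous_integrable_itv (a - 1) x cf.
rewrite /primitive Rintegral_itvB//.
- rewrite Rintegral_itv_obnd_cbnd//; apply: integrableS i => //.
  by apply: subset_itvr; rewrite bnd_simp lerBlDr lerDl.
- by rewrite bnd_simp lerBlDr lerDl.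
Qed.

Lemma primitive_oo b : a <= b -> derivable_oo_LRcontinuous (primitive a f) a b.
Proof.
move=> ab.
have c x : a <= x -> {for x, continuous (primitive a f)}.
  by move=> /primitive_is_derive[d1 _]; apply: differentiable_continuous; exact/derivable1_diffP.
split.
- by move=> x; rewrite in_itv/= => /andP[/ltW /primitive_is_derive[]].
- by apply: cvg_at_right_filter; exact: c.
- by apply: cvg_at_left_filter; exact: c.
Qed.

Lemma primitive_derive b : {in `]a, b[, derive1 (primitive a f) =1 f}.
Proof.
move=> x; rewrite in_itv/= => /andP[/ltW /primitive_is_derive[_ h] _].
by rewrite derive1E.
Qed.

Lemma primitive_is_derive_on b x : x \in `[a, b] ->
  is_derive_on a b (primitive a f) x (f x).
Proof.
rewrite in_itv/= => /andP[ax _].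
by apply: is_derive_on_is_derive; exact: primitive_is_derive.
Qed.

End primitive.

Section du_bois_reymond.
Context {R : realType} (a b : R).
Hypothesis ab : a < b.
Local Notation leb := (@lebesgue_measure R).

(** The primitive is squeezed between 0 and the total integral, hence vanishes on [a, b], and so
    does its derivative [f]. *)
Lemma continuous_int0_eq0 (f : R -> R) : continuous f ->
  (forall x, 0 <= f x) -> \int[leb]_(t in `[a, b]) f t = 0 ->
  forall x, x \in `[a, b] -> f x = 0.
Proof.
move=> cf f0 If x xab.
have P0 y : y \in `[a, b] -> primitive a f y = 0.
  rewrite in_itv/= => /andP[ay yb]; rewrite primitive_itv//.
  apply/eqP; rewrite eq_le Rintegral_ge0 ?andbT// -If.
  have H := @Rintegral_itvB _ f (BLeft a) (BRight b) y (continuous_integrable_itv a b cf).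
  rewrite -subr_ge0 H ?bnd_simp// Rintegral_ge0//.
have d1 := primitive_is_derive_on cf xab.
have d2 : is_derive_on a b (fun=> 0) x (f x).
  exact: (eq_is_derive_on xab P0).
rewrite -(is_derive_on_lim ab xab d2).
have : is_derive_on a b (fun=> 0 : R) x 0.
  by apply: is_derive_on_is_derive; exact: is_derive_cst.
exact: is_derive_on_lim.
Qed.

(** Integration by parts trades [P] for its primitive [W]; the boundary terms vanish because
    [primitive a phi] is 0 at both ends. Then [M - W] is orthogonal to every continuous function of
    mean zero, hence constant, and [M] inherits the derivative of [W]. *)
Lemma du_bois_reymond (M P : R -> R) :
  {within `[a, b], continuous M} -> {within `[a, b], continuous P} ->
  (forall phi : R -> R, continuous phi -> primitive a phi b = 0 ->
    \int[leb]_(t in `[a, b]) (P t * primitive a phi t + M t * phi t) = 0) ->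
  forall x, x \in `[a, b] -> is_derive_on a b M x (P x).
Proof.
move=> cM cP H x xab; have leab := ltW ab.
pose Q := P \o clamp a b; have cQ : continuous Q by exact: continuous_comp_clamp.
pose W := primitive a Q.
have cW : {within `[a, b], continuous W}.
  by apply: derivable_oo_LRcontinuous_within; exact: primitive_oo.
pose g := (fun t => M t - W t) \o clamp a b.
have cMW : {within `[a, b], continuous (fun t => M t - W t)}.
  by move=> t; apply: cvgB; [exact: cM|exact: cW].
have cg : continuous g by exact: continuous_comp_clamp.
pose m := (\int[leb]_(t in `[a, b]) g t) / (b - a).
(* [phi] is [M - W] minus its mean; testing with it gives [\int phi ^+ 2 = 0]. *)
pose phi t := g t - m.
have cphi : continuous phi by move=> t; apply: cvgB; [exact: cg|exact: cvg_cst].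
have iC (h : R -> R) : continuous h -> leb.-integrable `[a, b] (EFin \o h).
  exact: continuous_integrable_itv.
have Iphi : \int[leb]_(t in `[a, b]) phi t = 0.
  rewrite /phi RintegralB//; [|exact: iC|by apply: iC; exact: cst_continuous].
  rewrite Rintegral_cst//= lebesgue_measure_itv/= lte_fin ab/= /m.
  by rewrite divfK ?subrr// gt_eqF// subr_gt0.
have phi0 : primitive a phi b = 0 by rewrite primitive_itv.
have {}H := H _ cphi phi0.
have cpp : continuous (primitive a phi \o clamp a b).
  apply: continuous_comp_clamp => //.
  by apply: derivable_oo_LRcontinuous_within; exact: primitive_oo.
have cMc : continuous (M \o clamp a b) by exact: continuous_comp_clamp.
have cWc : continuous (W \o clamp a b) by exact: continuous_comp_clamp.
have parts : \int[leb]_(t in `[a, b]) (W t * phi t) = - \int[leb]_(t in `[a, b]) (Q t * primitive a phi t).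
  rewrite (@Rintegration_by_parts _ W (primitive a phi) Q phi)//.
  - by rewrite phi0 primitive_a mulr0 mulr0 subrr sub0r.
  - exact: continuous_subspaceT.
  - exact: primitive_oo.
  - exact: primitive_derive.
  - exact: continuous_subspaceT.
  - exact: primitive_oo.
  - exact: primitive_derive.
have Igphi : \int[leb]_(t in `[a, b]) (g t * phi t) = 0.
  rewrite -{}H.
  transitivity (\int[leb]_(t in `[a, b]) ((M \o clamp a b) t * phi t - (W \o clamp a b) t * phi t)).
    by apply: eq_Rintegral => t _; rewrite /g /= mulrBl.
  have cM' : continuous (fun t => (M \o clamp a b) t * phi t).
    by move=> t; apply: cvgM; [exact: cMc|exact: cphi].
  have cW' : continuous (fun t => (W \o clamp a b) t * phi t).
    by move=> t; apply: cvgM; [exact: cWc|exact: cphi].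
  have cQ' : continuous (fun t => Q t * (primitive a phi \o clamp a b) t).
    by move=> t; apply: cvgM; [exact: cQ|exact: cpp].
  rewrite RintegralB//; [|exact: iC|exact: iC].
  rewrite [X in _ - X](_ : _ = \int[leb]_(t in `[a, b]) (W t * phi t)); last first.
    by apply: eq_Rintegral => t tab; rewrite /= clamp_id//; move: tab; rewrite inE.
  rewrite parts opprK addrC.
  rewrite (_ : \int[leb]_(t in `[a, b]) (Q t * primitive a phi t) =
    \int[leb]_(t in `[a, b]) (Q t * (primitive a phi \o clamp a b) t)); last first.
    by apply: eq_Rintegral => t tab; rewrite /= clamp_id//; move: tab; rewrite inE.
  rewrite -RintegralD//; [|exact: iC|exact: iC].
  by apply: eq_Rintegral => t tab; rewrite /Q /= clamp_id//; move: tab; rewrite inE.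
have Iphi2 : \int[leb]_(t in `[a, b]) (phi t ^+ 2) = 0.
  transitivity (\int[leb]_(t in `[a, b]) (g t * phi t - m * phi t)).
    by apply: eq_Rintegral => t _; rewrite -mulrBl expr2.
  rewrite RintegralB ?Igphi ?RintegralZl ?Iphi ?mulr0 ?subrr//; [exact: iC| |].
  - by apply: iC => t; apply: cvgM; [exact: cg|exact: cphi].
  - by apply: iC => t; apply: cvgM; [exact: cvg_cst|exact: cphi].
have phiE t : t \in `[a, b] -> phi t = 0.
  move=> tab; apply/eqP; rewrite -sqrf_eq0; apply/eqP.
  apply: (@continuous_int0_eq0 (fun t => phi t ^+ 2)) => //.
  - by move=> u; apply: cvgM; exact: cphi.
  - by move=> u; exact: sqr_ge0.
have WM t : t \in `[a, b] -> W t + m = M t.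
  move=> tab; have := phiE _ tab; rewrite /phi /g /= clamp_id// => /eqP.
  by rewrite subr_eq0 => /eqP <-; rewrite addrC subrK.
apply: (eq_is_derive_on xab WM).
have -> : P x = Q x + 0 by rewrite /Q /= clamp_id// addr0.
apply: is_derive_on_is_derive; apply: is_deriveD.
by apply: primitive_is_derive => //; move: xab; rewrite in_itv => /andP[].
Qed.

End du_bois_reymond.

(** * Fractional operators *)

Section integral_of_continuous.
Context {R : realType} (a b : R).
Local Notation leb := (@lebesgue_measure R).
Implicit Types f g : R -> R.
Local Notation "'cont' f" := {within `[a, b], continuous f} (at level 10, f at next level).

Lemma within_integrable f : cont f -> leb.-integrable `[a, b] (EFin \o f).
Proof. by move=> cf; apply: continuous_compact_integrable => //; exact: segment_compact. Qed.

Lemma within_continuous_mul f g : cont f -> cont g -> cont (fun t => f t * g t).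
Proof. by move=> cf cg t; apply: cvgM; [exact: cf|exact: cg]. Qed.

Lemma within_continuous_add f g : cont f -> cont g -> cont (fun t => f t + g t).
Proof. by move=> cf cg t; apply: cvgD; [exact: cf|exact: cg]. Qed.

Lemma within_continuous_sub f g : cont f -> cont g -> cont (fun t => f t - g t).
Proof. by move=> cf cg t; apply: cvgB; [exact: cf|exact: cg]. Qed.

Lemma within_continuous_scale (c : R) f : cont f -> cont (fun t => c * f t).
Proof. by move=> cf t; apply: cvgM; [exact: cvg_cst|exact: cf]. Qed.

Lemma cont_RintegralD f g : cont f -> cont g ->
  \int[leb]_(t in `[a, b]) (f t + g t) =
  \int[leb]_(t in `[a, b]) f t + \int[leb]_(t in `[a, b]) g t.
Proof. by move=> cf cg; rewrite RintegralD//; exact: within_integrable. Qed.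

Lemma cont_RintegralB f g : cont f -> cont g ->
  \int[leb]_(t in `[a, b]) (f t - g t) =
  \int[leb]_(t in `[a, b]) f t - \int[leb]_(t in `[a, b]) g t.
Proof. by move=> cf cg; rewrite RintegralB//; exact: within_integrable. Qed.

Lemma cont_RintegralZ c f : cont f ->
  \int[leb]_(t in `[a, b]) (c * f t) = c * \int[leb]_(t in `[a, b]) f t.
Proof. by move=> cf; rewrite RintegralZl//; exact: within_integrable. Qed.

Lemma cont_norm_Rintegral_le f M : a <= b -> cont f ->
  (forall t, t \in `[a, b] -> `|f t| <= M) ->
  `|\int[leb]_(t in `[a, b]) f t| <= M * (b - a).
Proof.
move=> ab cf fM.
have cM : cont (cst M) by move=> t; exact: cvg_cst.
have -> : M * (b - a) = \int[leb]_(t in `[a, b]) M.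
  rewrite Rintegral_cst//= lebesgue_measure_itv/= lte_fin.
  case: ltP => //= ba; have -> : b = a by apply/eqP; rewrite eq_le ab ba.
  by rewrite subrr.
apply: le_trans (le_normr_Rintegral _ (within_integrable cf)) _ => //.
apply: le_Rintegral => //; last exact: within_integrable.
exact: integrable_norm (within_integrable cf).
Qed.

End integral_of_continuous.

(** * Riemann-Liouville integrals of continuous functions *)

Section rl_operators.
Context {R : realType} (a b : R).
Hypothesis ab : a < b.
Local Notation leb := (@lebesgue_measure R).
Local Notation clampf f := (f \o clamp a b).
Implicit Types (f g : R -> R) (mu : R).

Let leab : a <= b := ltW ab.

(** At [s = 0] this is a matter of default values: 0 to a nonzero power is 0, like the kernel,
    whereas [mu = 1] would give 0 to the power 0, which is 1. *)
Lemma rlker_powR mu s : mu != 1 -> 0 <= s -> rlker mu s = s `^ (mu - 1).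
Proof.
move=> mu1; rewrite le_eqVlt => /predU1P[<-|s0]; rewrite /rlker ?s0//.
by rewrite ltxx powR0// subr_eq0.
Qed.

Lemma RLI_leftE mu f x : 0 < mu < 1 -> x \in `[a, b] ->
  RLI_left a mu f x =
  (Gamma mu)^-1 * \int[leb]_(t in `[a, b]) (rlker mu (x - t) * clampf f t).
Proof.
move=> /andP[_ mu1]; rewrite in_itv/= => /andP[ax xb]; congr (_ * _).
rewrite Rintegral_mkcond [RHS]Rintegral_mkcond; apply: eq_Rintegral => t _.
rewrite !patchE !mem_setE !in_itv/=.
have [at_|//] := leP a t; have [tx|xt]/= := leP t x.
  rewrite (le_trans tx xb) clamp_id ?in_itv/= ?at_ ?(le_trans tx xb)//.
  by rewrite rlker_powR ?subr_ge0// lt_eqF.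
by case: ifP => // _; rewrite /rlker subr_gt0 ltNge (ltW xt) mul0r.
Qed.

Lemma RLI_rightE mu f x : 0 < mu < 1 -> x \in `[a, b] ->
  RLI_right b mu f x =
  (Gamma mu)^-1 * \int[leb]_(t in `[a, b]) (rlker mu (t - x) * clampf f t).
Proof.
move=> /andP[_ mu1]; rewrite in_itv/= => /andP[ax xb]; congr (_ * _).
rewrite Rintegral_mkcond [RHS]Rintegral_mkcond; apply: eq_Rintegral => t _.
rewrite !patchE !mem_setE !in_itv/=.
have [tb|//] := leP t b; rewrite ?andbT ?andbF//.
have [xt|tx] := leP x t.
  rewrite (le_trans ax xt) clamp_id ?in_itv/= ?tb ?(le_trans ax xt)//.
  by rewrite rlker_powR ?subr_ge0// lt_eqF.
by case: ifP => // _; rewrite /rlker subr_gt0 ltNge (ltW tx) mul0r.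
Qed.

Lemma continuous_RLI_left_exists mu f x : 0 < mu < 1 -> x \in `[a, b] ->
  {within `[a, b], continuous f} -> RLI_left_exists a mu f x.
Proof.
move=> mu01 xab cf; have /andP[_ mu1] := mu01.
have xab' : a <= x <= b by move: xab; rewrite in_itv.
have /andP[ax xb] := xab'.
have i := integrable_rlker_mul mu01 (continuous_comp_clamp leab cf) xab'.
have {}i : leb.-integrable `[a, x] (fun t => (rlker mu (x - t) * clampf f t)%:E).
  by apply: integrableS i => //; apply: subset_itvl; rewrite bnd_simp.
apply: eq_integrable i => // t; rewrite inE/= in_itv/= => /andP[at_ tx].
rewrite clamp_id ?in_itv/= ?at_ ?(le_trans tx xb)//.
by rewrite rlker_powR ?subr_ge0// lt_eqF.
Qed.

Lemma continuous_RLI_right_exists mu f x : 0 < mu < 1 -> x \in `[a, b] ->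
  {within `[a, b], continuous f} -> RLI_right_exists b mu f x.
Proof.
move=> mu01 xab cf; have /andP[_ mu1] := mu01.
have xab' : a <= x <= b by move: xab; rewrite in_itv.
have /andP[ax xb] := xab'.
have i := integrable_rlker_mulN mu01 (continuous_comp_clamp leab cf) xab'.
have {}i : leb.-integrable `[x, b] (fun t => (rlker mu (t - x) * clampf f t)%:E).
  by apply: integrableS i => //; apply: subset_itvr; rewrite bnd_simp.
apply: eq_integrable i => // t; rewrite inE/= in_itv/= => /andP[xt tb].
rewrite clamp_id ?in_itv/= ?tb ?(le_trans ax xt)//.
by rewrite rlker_powR ?subr_ge0// lt_eqF.
Qed.

Lemma within_eq_continuous (V : topologicalType) (f g : R -> V) :
  (forall t, t \in `[a, b] -> f t = g t) ->
  {within `[a, b], continuous f} -> {within `[a, b], continuous g}.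
Proof.
move=> fg cf; apply: (subspace_eq_continuous _ cf) => t.
by rewrite inE => tab; exact: fg.
Qed.

Lemma RLI_left_continuous mu f : 0 < mu < 1 ->
  {within `[a, b], continuous f} -> {within `[a, b], continuous (RLI_left a mu f)}.
Proof.
move=> mu01 cf.
apply: (@within_eq_continuous _ (fun x =>
  (Gamma mu)^-1 * \int[leb]_(t in `[a, b]) (rlker mu (x - t) * clampf f t))).
  by move=> t tab; rewrite RLI_leftE.
by apply: within_continuous_scale; apply: rlker_continuous => //; exact: continuous_comp_clamp.
Qed.

Lemma RLI_right_continuous mu f : 0 < mu < 1 ->
  {within `[a, b], continuous f} -> {within `[a, b], continuous (RLI_right b mu f)}.
Proof.
move=> mu01 cf.
apply: (@within_eq_continuous _ (fun x =>
  (Gamma mu)^-1 * \int[leb]_(t in `[a, b]) (rlker mu (t - x) * clampf f t))).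
  by move=> t tab; rewrite RLI_rightE.
by apply: within_continuous_scale; apply: rlker_continuousN => //; exact: continuous_comp_clamp.
Qed.

Lemma eq_RLI_left mu f g x : 0 < mu < 1 -> x \in `[a, b] ->
  (forall t, t \in `[a, b] -> f t = g t) -> RLI_left a mu f x = RLI_left a mu g x.
Proof.
move=> mu01 xab fg; rewrite !RLI_leftE//; congr (_ * _).
by apply: eq_Rintegral => t _ /=; rewrite fg//; exact: clamp_itv.
Qed.

Lemma eq_RLI_right mu f g x : 0 < mu < 1 -> x \in `[a, b] ->
  (forall t, t \in `[a, b] -> f t = g t) -> RLI_right b mu f x = RLI_right b mu g x.
Proof.
move=> mu01 xab fg; rewrite !RLI_rightE//; congr (_ * _).
by apply: eq_Rintegral => t _ /=; rewrite fg//; exact: clamp_itv.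
Qed.

Lemma RLI_left_linear mu f g c x : 0 < mu < 1 -> x \in `[a, b] ->
  {within `[a, b], continuous f} -> {within `[a, b], continuous g} ->
  RLI_left a mu (fun t => f t + c * g t) x =
  RLI_left a mu f x + c * RLI_left a mu g x.
Proof.
move=> mu01 xab cf cg; rewrite !RLI_leftE// mulrCA -mulrDr; congr (_ * _).
have xab' : a <= x <= b by move: xab; rewrite in_itv.
have fi := integrable_rlker_mul mu01 (continuous_comp_clamp leab cf) xab'.
have gi := integrable_rlker_mul mu01 (continuous_comp_clamp leab cg) xab'.
rewrite -RintegralZl// -RintegralD//; last exact: integrable_EFinZ.
by apply: eq_Rintegral => t _ /=; rewrite mulrDr mulrCA.
Qed.

Lemma RLI_right_linear mu f g c x : 0 < mu < 1 -> x \in `[a, b] ->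
  {within `[a, b], continuous f} -> {within `[a, b], continuous g} ->
  RLI_right b mu (fun t => f t + c * g t) x =
  RLI_right b mu f x + c * RLI_right b mu g x.
Proof.
move=> mu01 xab cf cg; rewrite !RLI_rightE// mulrCA -mulrDr; congr (_ * _).
have xab' : a <= x <= b by move: xab; rewrite in_itv.
have fi := integrable_rlker_mulN mu01 (continuous_comp_clamp leab cf) xab'.
have gi := integrable_rlker_mulN mu01 (continuous_comp_clamp leab cg) xab'.
rewrite -RintegralZl// -RintegralD//; last exact: integrable_EFinZ.
by apply: eq_Rintegral => t _ /=; rewrite mulrDr mulrCA.
Qed.

Lemma RLI_adjoint mu f g : 0 < mu < 1 ->
  {within `[a, b], continuous f} -> {within `[a, b], continuous g} ->
  \int[leb]_(x in `[a, b]) (f x * RLI_left a mu g x) =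
  \int[leb]_(x in `[a, b]) (RLI_right b mu f x * g x).
Proof.
move=> mu01 cf cg.
have cf' := continuous_comp_clamp leab cf; have cg' := continuous_comp_clamp leab cg.
transitivity ((Gamma mu)^-1 * \int[leb]_(x in `[a, b]) (clampf f x *
    \int[leb]_(t in `[a, b]) (rlker mu (x - t) * clampf g t))).
  rewrite -cont_RintegralZ; last first.
    apply: within_continuous_mul; first exact: (continuous_subspaceT cf').
    exact: (rlker_continuous mu01 cg').
  apply: eq_Rintegral => x; rewrite inE/= => xab.
  by rewrite RLI_leftE//= clamp_id// mulrCA.
rewrite rlker_fubini// -cont_RintegralZ; last first.
  apply: within_continuous_mul; first exact: (continuous_subspaceT cg').
  exact: (rlker_continuousN mu01 cf').
apply: eq_Rintegral => x; rewrite inE/= => xab.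
by rewrite [in RHS]RLI_rightE//= clamp_id// mulrCA mulrC.
Qed.

End rl_operators.

Section combined.
Context {R : realType} (a b alpha beta gamma : R).
Hypothesis ab : a < b.
Hypothesis alpha01 : 0 < alpha < 1.
Hypothesis beta01 : 0 < beta < 1.
Local Notation leb := (@lebesgue_measure R).

Let leab : a <= b := ltW ab.
Let alpha01' : 0 < 1 - alpha < 1.
Proof. by case/andP: alpha01 => *; apply/andP; split; lra. Qed.
Let beta01' : 0 < 1 - beta < 1.
Proof. by case/andP: beta01 => *; apply/andP; split; lra. Qed.

(* The combined Caputo derivative of a function whose derivative is [g]. *)
Definition rl_comb (g : R -> R) (x : R) : R :=
  gamma * RLI_left a (1 - alpha) g x - (1 - gamma) * RLI_right b (1 - beta) g x.

(** The transpose of [rl_comb]: left and right integrals trade places but keep their orders and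
    coefficients. Applied to d_wF it is the fractional part of [EL_momentum]. *)
Definition rl_comb_adjoint (g : R -> R) (x : R) : R :=
  gamma * RLI_right b (1 - alpha) g x - (1 - gamma) * RLI_left a (1 - beta) g x.

Lemma rl_comb_continuous (g : R -> R) :
  {within `[a, b], continuous g} -> {within `[a, b], continuous (rl_comb g)}.
Proof.
move=> cg.
have c1 := within_continuous_scale (c := gamma) (RLI_left_continuous ab alpha01' cg).
have c2 := within_continuous_scale (c := 1 - gamma) (RLI_right_continuous ab beta01' cg).
by move=> t; apply: cvgB; [exact: c1|exact: c2].
Qed.

Lemma rl_comb_adjoint_continuous (g : R -> R) :
  {within `[a, b], continuous g} -> {within `[a, b], continuous (rl_comb_adjoint g)}.
Proof.
move=> cg.
have c1 := within_continuous_scale (c := gamma) (RLI_right_continuous ab alpha01' cg).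
have c2 := within_continuous_scale (c := 1 - gamma) (RLI_left_continuous ab beta01' cg).
by move=> t; apply: cvgB; [exact: c1|exact: c2].
Qed.

Lemma eq_rl_comb (g h : R -> R) x : x \in `[a, b] ->
  (forall t, t \in `[a, b] -> g t = h t) -> rl_comb g x = rl_comb h x.
Proof.
by move=> xab gh; rewrite /rl_comb (eq_RLI_left ab alpha01' xab gh) (eq_RLI_right ab beta01' xab gh).
Qed.

Lemma rl_comb_linear (g h : R -> R) (c x : R) : x \in `[a, b] ->
  {within `[a, b], continuous g} -> {within `[a, b], continuous h} ->
  rl_comb (fun t => g t + c * h t) x = rl_comb g x + c * rl_comb h x.
Proof.
move=> xab cg ch.
rewrite /rl_comb (RLI_left_linear ab c alpha01' xab cg ch).
rewrite (RLI_right_linear ab c beta01' xab cg ch); ring.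
Qed.

Lemma rl_comb_adjointP (f g : R -> R) :
  {within `[a, b], continuous f} -> {within `[a, b], continuous g} ->
  \int[leb]_(x in `[a, b]) (f x * rl_comb g x) =
  \int[leb]_(x in `[a, b]) (rl_comb_adjoint f x * g x).
Proof.
move=> cf cg.
have C1 := within_continuous_mul cf (RLI_left_continuous ab alpha01' cg).
have C2 := within_continuous_mul cf (RLI_right_continuous ab beta01' cg).
have C3 := within_continuous_mul (RLI_right_continuous ab alpha01' cf) cg.
have C4 := within_continuous_mul (RLI_left_continuous ab beta01' cf) cg.
transitivity (gamma * \int[leb]_(x in `[a, b]) (f x * RLI_left a (1 - alpha) g x) -
  (1 - gamma) * \int[leb]_(x in `[a, b]) (f x * RLI_right b (1 - beta) g x)).
  rewrite -(cont_RintegralZ _ C1) -(cont_RintegralZ _ C2).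
  rewrite -(cont_RintegralB (within_continuous_scale C1) (within_continuous_scale C2)).
  by apply: eq_Rintegral => t _; rewrite /rl_comb; ring.
rewrite (RLI_adjoint ab alpha01' cf cg).
rewrite (_ : \int[leb]_(x in `[a, b]) (f x * RLI_right b (1 - beta) g x) =
  \int[leb]_(x in `[a, b]) (RLI_left a (1 - beta) f x * g x)); last first.
  under eq_Rintegral do rewrite mulrC.
  by rewrite -(RLI_adjoint ab beta01' cg cf); apply: eq_Rintegral => t _; rewrite mulrC.
rewrite -(cont_RintegralZ _ C3) -(cont_RintegralZ _ C4).
rewrite -(cont_RintegralB (within_continuous_scale C3) (within_continuous_scale C4)).
by apply: eq_Rintegral => t _; rewrite /rl_comb_adjoint; ring.
Qed.

(** [rl_comb phi] depends on [phi] nonlocally; moved onto [T] by transposition, it leaves a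
    pointwise product with [phi], to which the classical lemma applies. *)
Lemma fractional_du_bois_reymond (P Q T : R -> R) :
  {within `[a, b], continuous P} -> {within `[a, b], continuous Q} ->
  {within `[a, b], continuous T} ->
  (forall phi : R -> R, continuous phi -> primitive a phi b = 0 ->
    \int[leb]_(t in `[a, b])
      (P t * primitive a phi t + Q t * phi t + T t * rl_comb phi t) = 0) ->
  forall x, x \in `[a, b] ->
    is_derive_on a b (fun x => Q x + rl_comb_adjoint T x) x (P x).
Proof.
move=> cP cQ cT H; apply: du_bois_reymond => //.
  by move=> t; apply: cvgD; [exact: cQ|exact: rl_comb_adjoint_continuous].
move=> phi cphi phi0; rewrite -[RHS](H _ cphi phi0).
have cphi' := @continuous_subspaceT _ _ `[a, b]%classic _ cphi.
have cprim := derivable_oo_LRcontinuous_within (primitive_oo cphi leab).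
have C1 := within_continuous_mul cP cprim.
have C2 := within_continuous_mul cQ cphi'.
have C3 := within_continuous_mul cT (rl_comb_continuous cphi').
have C4 := within_continuous_mul (rl_comb_adjoint_continuous cT) cphi'.
rewrite (cont_RintegralD (within_continuous_add C1 C2) C3) (cont_RintegralD C1 C2).
rewrite rl_comb_adjointP//.
rewrite -(cont_RintegralD C1 C2) -(cont_RintegralD (within_continuous_add C1 C2) C4).
by apply: eq_Rintegral => t _; ring.
Qed.

End combined.

Section row_functions.
Context {R : realType} (A : set R) (N : nat).

Lemma within_continuous_coord (f : R -> 'rV[R]_N) k :
  {within A, continuous f} -> {within A, continuous (fun t => f t 0 k)}.
Proof.
move=> cf t.
exact: (cvg_comp _ _ (cf t) (@coord_continuous _ _ _ 0 k (f t))).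
Qed.

Lemma within_continuous_row (f : R -> 'rV[R]_N) :
  (forall k, {within A, continuous (fun t => f t 0 k)}) -> {within A, continuous f}.
Proof.
move=> cf.
rewrite (_ : f = fun t => \sum_(k < N) f t 0 k *: delta_mx 0 k); last first.
  by apply/funext => t; rewrite [LHS]row_sum_delta.
elim: (index_enum _) => [|k s IH].
  rewrite (_ : (fun t => _) = fun=> 0); last by apply/funext => t; rewrite big_nil.
  by move=> t; exact: cvg_cst.
rewrite (_ : (fun t => _) = fun t => f t 0 k *: delta_mx 0 k +
  \sum_(k <- s) f t 0 k *: delta_mx 0 k); last by apply/funext => t; rewrite big_cons.
by move=> t; apply: cvgD; [apply: cvgZr_tmp; exact: (cf k t)|exact: IH].
Qed.

End row_functions.

(** * The space of curves on which the functionals live *)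

Section space_D.
Context {R : realType} (a b alpha beta gamma : R) (N : nat).
Hypothesis ab : a < b.
Hypothesis alpha01 : 0 < alpha < 1.
Hypothesis beta01 : 0 < beta < 1.
Local Notation V := 'rV[R]_N.
Implicit Types y f g : R -> V.

Let alpha01' : 0 < 1 - alpha < 1.
Proof. by case/andP: alpha01 => *; apply/andP; split; lra. Qed.
Let beta01' : 0 < 1 - beta < 1.
Proof. by case/andP: beta01 => *; apply/andP; split; lra. Qed.

Definition C1_on y : Prop :=
  (forall x, x \in `[a, b] -> derivable_on a b y x) /\
  {within `[a, b], continuous (derive_on a b y)}.

Lemma derive_on_coord y x k : x \in `[a, b] -> derivable_on a b y x ->
  derive_on a b (fun t => y t 0 k) x = derive_on a b y x 0 k.
Proof.
move=> xab dy; apply: (is_derive_on_lim ab xab).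
exact: (is_derive_on_coord (derivable_on_is_derive dy)).
Qed.

Lemma caputo_combE y x k : C1_on y -> x \in `[a, b] ->
  caputo_comb a b alpha beta gamma y x 0 k =
  rl_comb a b alpha beta gamma (fun t => derive_on a b y t 0 k) x.
Proof.
move=> [dy cy] xab; rewrite mxE /rl_comb /caputo_left /caputo_right.
have dE t : t \in `[a, b] -> derive_on a b (fun t => y t 0 k) t = derive_on a b y t 0 k.
  by move=> tab; apply: derive_on_coord => //; exact: dy.
rewrite (eq_RLI_left ab alpha01' xab dE).
set d := fun t => derive_on a b y t 0 k.
have cd : {within `[a, b], continuous d} by exact: within_continuous_coord.
rewrite (_ : RLI_right _ _ _ _ = - RLI_right b (1 - beta) d x) ?mulrN//.
(* [- d] is written [d + -2 * d] to match the shape [f + c * g] of the linearity lemma. *)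
transitivity (RLI_right b (1 - beta) (fun t => d t + -2 * d t) x).
  by apply: (eq_RLI_right ab) => // t tab; rewrite dE// -/(d t); ring.
by rewrite (RLI_right_linear ab)//; ring.
Qed.

(** Fractional integrals of the continuous function y' exist at every point and are continuous, by
    the Hoelder estimate. Membership of a test function is thus checked on its first derivative. *)
Lemma in_DP y : in_D a b alpha beta gamma y <-> C1_on y.
Proof.
split=> [[dy cy _ _]//|[dy cy]]; split => //.
  move=> x xab k.
  have cd : {within `[a, b], continuous (derive_on a b (fun t => y t 0 k))}.
    apply: (@within_eq_continuous _ a b _ (fun t => derive_on a b y t 0 k)).
      by move=> t tab; rewrite derive_on_coord//; exact: dy.
    exact: within_continuous_coord.
  split; first exact: (continuous_RLI_left_exists ab).
  by apply: (continuous_RLI_right_exists ab) => // t; apply: cvgN; exact: cd.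
apply: within_continuous_row => k.
apply: (@within_eq_continuous _ a b _
    (rl_comb a b alpha beta gamma (fun t => derive_on a b y t 0 k))).
  by move=> t tab; rewrite caputo_combE.
apply: rl_comb_continuous => //; exact: within_continuous_coord.
Qed.

(** Bundling the three arguments into one point of a normed space makes a functional the integral of
    a Lagrangian along a continuous curve, which depends linearly on [y]. *)
Definition jet y (x : R) : V * V * V :=
  (y x, derive_on a b y x, caputo_comb a b alpha beta gamma y x).

Lemma jet_continuous y : in_D a b alpha beta gamma y -> {within `[a, b], continuous (jet y)}.
Proof.
move=> yD; have [dy cy _ cc] := yD.
have c0 := is_derive_on_continuous dy.
by move=> t; exact: (cvg_pair (cvg_pair (c0 t) (cy t)) (cc t)).
Qed.

Lemma derive_on_ZD f g c x : x \in `[a, b] ->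
  derivable_on a b f x -> derivable_on a b g x ->
  derive_on a b (fun t => f t + c *: g t) x = derive_on a b f x + c *: derive_on a b g x.
Proof.
move=> xab df dg; apply: (is_derive_on_lim ab xab).
have df' : is_derive_on a b f x (derive_on a b f x) := df.
have dg' : is_derive_on a b g x (derive_on a b g x) := dg.
exact: (is_derive_onZD (c := c) df' dg').
Qed.

Lemma in_D_ZD f g c : in_D a b alpha beta gamma f -> in_D a b alpha beta gamma g ->
  in_D a b alpha beta gamma (fun t => f t + c *: g t).
Proof.
move=> /in_DP[df cf] /in_DP[dg cg]; apply/in_DP; split.
  move=> x xab; apply: is_derive_on_cvg; apply: is_derive_onZD.
    exact: derivable_on_is_derive (df _ xab).
  exact: derivable_on_is_derive (dg _ xab).
apply: (@within_eq_continuous _ a b _ (fun t => derive_on a b f t + c *: derive_on a b g t)).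
  by move=> t tab; rewrite derive_on_ZD//; [exact: df|exact: dg].
by move=> t; apply: cvgD; [exact: cf|apply: cvgZl_tmp; exact: cg].
Qed.

Lemma jet_ZD f g c x : in_D a b alpha beta gamma f -> in_D a b alpha beta gamma g ->
  x \in `[a, b] -> jet (fun t => f t + c *: g t) x = jet f x + c *: jet g x.
Proof.
move=> fD gD xab; have [df cf] := (in_DP f).1 fD; have [dg cg] := (in_DP g).1 gD.
have hC := (in_DP _).1 (in_D_ZD c fD gD).
have E : caputo_comb a b alpha beta gamma (fun t => f t + c *: g t) x =
    caputo_comb a b alpha beta gamma f x + c *: caputo_comb a b alpha beta gamma g x.
  apply/rowP => k; rewrite [RHS]mxE [X in _ + X]mxE.
  pose D (u : R -> V) t : R := derive_on a b u t 0 k.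
  have cfk : {within `[a, b], continuous (D f)} := within_continuous_coord (k := k) cf.
  have cgk : {within `[a, b], continuous (D g)} := within_continuous_coord (k := k) cg.
  transitivity (rl_comb a b alpha beta gamma (D (fun t => f t + c *: g t)) x).
    exact: caputo_combE.
  transitivity (rl_comb a b alpha beta gamma (fun t => D f t + c * D g t) x).
    apply: (eq_rl_comb gamma ab alpha01 beta01 xab) => t tab.
    have := derive_on_ZD c tab (df _ tab) (dg _ tab).
    by move/(congr1 (fun M : V => M 0 k)) => E; apply: etrans E _; rewrite mxE; congr (_ + _); rewrite mxE.
  transitivity (rl_comb a b alpha beta gamma (D f) x + c * rl_comb a b alpha beta gamma (D g) x).
    exact: rl_comb_linear.
  have e1 := caputo_combE k (conj df cf) xab.
  have e2 := caputo_combE k (conj dg cg) xab.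
  exact: (esym (f_equal2 (fun u v : R => u + c * v) e1 e2)).
have E' := derive_on_ZD c xab (df _ xab) (dg _ xab).
transitivity ((f x + c *: g x, derive_on a b f x + c *: derive_on a b g x,
  caputo_comb a b alpha beta gamma f x + c *: caputo_comb a b alpha beta gamma g x) : V * V * V).
  by rewrite -E -E'.
by [].
Qed.

(** Both claims go through one induction, because linearity of the jet at each step presupposes that
    the partial sum lies in D. *)
Lemma in_D_jet_sum (I : Type) (s : seq I) (c : I -> R) (h : I -> R -> V) y :
  in_D a b alpha beta gamma y -> (forall l, in_D a b alpha beta gamma (h l)) ->
  in_D a b alpha beta gamma (fun t => y t + \sum_(l <- s) c l *: h l t) /\
  (forall x, x \in `[a, b] -> jet (fun t => y t + \sum_(l <- s) c l *: h l t) x =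
     jet y x + \sum_(l <- s) c l *: jet (h l) x).
Proof.
move=> yD hD; elim: s => [|l s [IHD IHj]].
  rewrite (_ : (fun _ => _) = y); last by apply/funext => t; rewrite big_nil addr0.
  by split => // x _; rewrite big_nil addr0.
rewrite (_ : (fun t => _) = (fun t => y t + \sum_(l <- s) c l *: h l t + c l *: h l t)); last first.
  by apply/funext => t; rewrite big_cons -addrA (addrC (c l *: _)).
split; first exact: (in_D_ZD (c l) IHD (hD l)).
move=> x xab; apply: etrans (jet_ZD (c l) IHD (hD l) xab) _.
have aux (W : zmodType) (J u A B : W) : J = u + B -> J + A = u + (A + B).
  by move=> ->; rewrite -addrA (addrC B).
by rewrite big_cons; exact: aux (IHj _ xab).
Qed.

Lemma primitive_in_D phi k : continuous phi ->
  in_D a b alpha beta gamma (fun x => primitive a phi x *: delta_mx 0 k : V).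
Proof.
move=> cphi; apply/in_DP; split => [x xab|].
  by apply: is_derive_on_cvg; apply: is_derive_on_scale; exact: (primitive_is_derive_on cphi xab).
apply: (@within_eq_continuous _ a b _ (fun t => phi t *: delta_mx 0 k)).
  move=> t tab; apply/esym/(is_derive_on_lim ab tab); apply: is_derive_on_scale.
  exact: (primitive_is_derive_on cphi tab).
by apply: continuous_subspaceT => t; apply: cvgZr_tmp; exact: cphi.
Qed.

Lemma jet_primitive phi k x : continuous phi -> x \in `[a, b] ->
  jet (fun x => primitive a phi x *: delta_mx 0 k : V) x =
  (primitive a phi x *: delta_mx 0 k, phi x *: delta_mx 0 k,
   rl_comb a b alpha beta gamma phi x *: delta_mx 0 k).
Proof.
move=> cphi xab; have hD := (in_DP _).1 (primitive_in_D k cphi).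
have dE t : t \in `[a, b] -> derive_on a b (fun x => primitive a phi x *: delta_mx 0 k : V) t =
    phi t *: delta_mx 0 k.
  move=> tab; apply: (is_derive_on_lim ab tab); apply: is_derive_on_scale.
  exact: (primitive_is_derive_on cphi tab).
rewrite /jet dE//.
suff -> : caputo_comb a b alpha beta gamma (fun x => primitive a phi x *: delta_mx 0 k : V) x =
  rl_comb a b alpha beta gamma phi x *: delta_mx 0 k by [].
apply/rowP => j; rewrite (caputo_combE j hD xab) [RHS]mxE mxE eqxx/=.
have cp : {within `[a, b], continuous phi} by exact: continuous_subspaceT.
(* The [j]-th coordinate of [phi t *: delta_mx 0 k] is [(j == k)%:R * phi t], written as [phi] plus
   a multiple of [phi] to fit [rl_comb_linear]. *)
transitivity (rl_comb a b alpha beta gamma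
    (fun t => phi t + ((j == k)%:R - 1) * phi t) x).
  by apply: eq_rl_comb => // t tab; rewrite dE// !mxE eqxx/=; ring.
by rewrite rl_comb_linear//; ring.
Qed.

End space_D.

(** * A multiplier rule in finite dimension *)

Lemma rV_entry_le (R : realType) (n : nat) (c : 'rV[R]_n) k : `|c 0 k| <= `|c|.
Proof.
by rewrite [leRHS]/Num.Def.normr /= mx_normrE; apply/bigmax_geP; right => /=; exists (0, k).
Qed.

Lemma rV_norm_le (R : realType) (n : nat) (c : 'rV[R]_n) (M : R) : 0 <= M ->
  (forall k, `|c 0 k| <= M) -> `|c| <= M.
Proof.
move=> M0 cM; rewrite /Num.Def.normr /= mx_normrE; apply/bigmax_leP; split => // -[i j] _ /=.
by rewrite ord1.
Qed.

Lemma rV_sum_le (R : realType) (n : nat) (lam : 'I_n -> R) (c : 'rV[R]_n) :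
  `|\sum_(l < n) lam l * c 0 l| <= (\sum_(l < n) `|lam l|) * `|c|.
Proof.
rewrite mulr_suml (le_trans (ler_norm_sum _ _ _))//; apply: ler_sum => l _.
by rewrite normrM ler_wpM2l// rV_entry_le.
Qed.

(* A point where [`|T c - c|] is minimal is fixed, since [T] halves distances. *)
Lemma rV_fixed_point (R : realType) (n : nat) (rho : R) (T : 'rV[R]_n -> 'rV[R]_n) :
  0 <= rho -> (forall c, `|c| <= rho -> `|T c| <= rho) ->
  (forall c c', `|c| <= rho -> `|c'| <= rho -> `|T c' - T c| <= 2^-1 * `|c' - c|) ->
  exists2 c, `|c| <= rho & T c = c.
Proof.
move=> rho0 Tball Tcontr.
pose A := [set c : 'rV[R]_n | `|c| <= rho].
have cA : compact A.
  apply: bounded_closed_compact.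
    by exists rho; split; [exact: num_real|move=> M rM c /= cr; exact: le_trans cr (ltW rM)].
  rewrite (_ : A = (fun c => `|c|) @^-1` [set x | x <= rho])//.
  by apply: closed_comp; [move=> c _; exact: norm_continuous|exact: closed_le].
have cT : {within A, continuous (fun c => `|T c - c|)}.
  apply/subspace_continuousP => c Ac; apply/cvgrPdist_lt => e e0.
  rewrite near_withinE; near=> c' => Ac'.
  rewrite (le_lt_trans (ler_dist_dist _ _))//.
  rewrite (_ : _ - _ = (T c - T c') - (c - c')); last first.
    by rewrite !opprB addrACA [RHS]addrACA (addrC (- c)).
  rewrite (le_lt_trans (ler_normB _ _))// (le_lt_trans (lerD (Tcontr _ _ Ac' Ac) (lexx _)))//.
  have : `|c - c'| < e / 2.
    by near: c'; apply: (@cvgr_dist_lt _ _ _ (nbhs c) _ id c) => //; rewrite divr_gt0.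
  by have := normr_ge0 (c - c'); lra.
have [|c /[!inE] Ac cmin] := EVT_min_rV _ cA cT.
  by exists 0; rewrite /A/= normr0.
exists c => //; apply/eqP; rewrite -subr_eq0 -normr_le0.
have ATc : A (T c) by exact: Tball.
have := cmin (T c); rewrite inE => /(_ ATc).
have := Tcontr _ _ Ac ATc; have := normr_ge0 (T c - c); lra.
Unshelve. all: by end_near. Qed.

(* The contraction [c |-> c - (F t c - F 0 0)] solves [F t c = F 0 0] with
   [`|c| <= eta * `|t|]; if [v != 0], a small [t] of sign opposite to [v] then
   makes [F0 t c < F0 0 0]. *)
Lemma multiplier_rule (R : realType) (r : nat) (F : R -> 'rV[R]_r -> 'rV[R]_r)
    (F0 : R -> 'rV[R]_r -> R) (v : R) (lam : 'I_r -> R) :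
  (forall eps : R, 0 < eps -> exists2 d : R, 0 < d & forall t c c',
    `|t| <= d -> `|c| <= d -> `|c'| <= d ->
    `|F t c' - F t c - (c' - c)| <= eps * `|c' - c|) ->
  (forall eps : R, 0 < eps -> exists2 d : R, 0 < d & forall t, `|t| <= d ->
    `|F t 0 - F 0 0| <= eps * `|t|) ->
  (forall eps : R, 0 < eps -> exists2 d : R, 0 < d & forall t c, `|t| <= d -> `|c| <= d ->
    `|F0 t c - F0 0 0 - (t * v + \sum_(l < r) lam l * c 0 l)| <= eps * (`|t| + `|c|)) ->
  (exists2 d : R, 0 < d & forall t c, `|t| <= d -> `|c| <= d ->
    F t c = F 0 0 -> F0 0 0 <= F0 t c) ->
  v = 0.
Proof.
move=> HF Ht H0 [d0 d0_gt0 Hmin]; have [//|v0] := eqVneq v 0; exfalso.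
have v_gt0 : 0 < `|v| by rewrite normr_gt0.
pose Lam := \sum_(l < r) `|lam l|.
have Lam0 : 0 <= Lam by apply: sumr_ge0.
(* The linear term [t * v] lowers [F0] by s |v|. With |c| <= eta s the [lam] part costs at most a
   quarter of this, and [eta <= 1] keeps [c] within the radius [s]. *)
pose eta := Num.min 1 (`|v| / (4 * (Lam + 1))).
have eta_gt0 : 0 < eta by rewrite lt_min ltr01/= divr_gt0// mulr_gt0// ltr_wpDl.
have eta1 : eta <= 1 by rewrite ge_min lexx.
have etaLam : Lam * eta <= `|v| / 4.
  have : eta <= `|v| / (4 * (Lam + 1)) by rewrite ge_min lexx orbT.
  rewrite ler_pdivlMr ?mulr_gt0 ?ltr_wpDl// => h.
  rewrite ler_pdivlMr//; apply: le_trans h.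
  rewrite (mulrC Lam) -mulrA ler_wpM2l ?(ltW eta_gt0)// mulrC ler_wpM2l// lerDl//.
(* The slope error 1/2 makes [T] halve distances. With [eta / 2], |T 0| + |T c - T 0| stays below
   eta s, so [T] preserves the ball. The error [|v| / 8] times s + |c| <= 2 s costs another quarter
   of s |v|, and a strict decrease remains. *)
have [d1 d1_gt0 H1] := HF 2^-1 ltac:(by rewrite invr_gt0).
have [d2 d2_gt0 H2] := Ht (eta / 2) ltac:(by rewrite divr_gt0).
have [d3 d3_gt0 H3] := H0 (`|v| / 8) ltac:(by rewrite divr_gt0).
pose s := Num.min d0 (Num.min d1 (Num.min d2 d3)).
have s_gt0 : 0 < s by rewrite !lt_min d0_gt0 d1_gt0 d2_gt0.
have /and4P[sd0 sd1 sd2 sd3] : [&& s <= d0, s <= d1, s <= d2 & s <= d3].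
  by have := lexx s; rewrite {2}/s !le_min.
pose t := - (Num.sg v) * s.
have tE : `|t| = s by rewrite /t normrM normrN normr_sg v0 mul1r gtr0_norm.
have tv : t * v = - (s * `|v|) by rewrite (normrEsg v) /t; ring.
have etas : eta * s <= s by rewrite ler_piMl// ltW.
have etas0 : 0 <= eta * s by rewrite mulr_ge0// ltW.
pose T c := c - (F t c - F 0 0).
have Tcontr c c' : `|c| <= eta * s -> `|c'| <= eta * s -> `|T c' - T c| <= 2^-1 * `|c' - c|.
  move=> cs c's; rewrite (_ : T c' - T c = - (F t c' - F t c - (c' - c))).
    rewrite normrN; apply: H1; rewrite ?tE//.
    - exact: le_trans cs (le_trans etas sd1).
    - exact: le_trans c's (le_trans etas sd1).
  by apply/rowP => i; rewrite !mxE; ring.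
have Tball c : `|c| <= eta * s -> `|T c| <= eta * s.
  move=> cs; have T0 : `|T 0| <= eta / 2 * s.
    by rewrite /T sub0r normrN; have := H2 t; rewrite tE; apply.
  have c0 : `|0 : 'rV[R]_r| <= eta * s by rewrite normr0.
  have := Tcontr _ _ c0 cs; rewrite subr0 => Tc.
  rewrite -(subrK (T 0) (T c)) (le_trans (ler_normD _ _))//.
  by rewrite (le_trans (lerD Tc T0))//; lra.
have [c cs Tc] := rV_fixed_point etas0 Tball Tcontr.
have Fc : F t c = F 0 0.
  by move/eqP: Tc; rewrite /T subr_eq addrC -subr_eq subrr eq_sym subr_eq0 => /eqP.
have cs' := le_trans cs etas.
have := Hmin t c; rewrite tE => /(_ sd0 (le_trans cs' sd0) Fc) Hle.
have := H3 t c; rewrite tE => /(_ sd3 (le_trans cs' sd3)) /ler_normlP[_].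
rewrite tv => H.
have S : \sum_(l < r) lam l * c 0 l <= `|v| / 4 * s.
  apply: le_trans (ler_norm _) _; apply: le_trans (rV_sum_le _ _) _.
  apply: le_trans (_ : Lam * (eta * s) <= _).
    by rewrite ler_wpM2l.
  by rewrite mulrA ler_wpM2r// ltW.
have E : `|v| / 8 * (s + `|c|) <= `|v| / 4 * s.
  have : `|v| / 8 * (s + `|c|) <= `|v| / 8 * (s + s).
    by rewrite ler_wpM2l ?divr_ge0// lerD2l.
  by move/le_trans; apply; lra.
have sv : 0 < s * `|v| by rewrite mulr_gt0.
lra.
Qed.

(** * Strict differentiability of the functionals *)

Lemma mean_value_bound (R : realType) (g dg : R -> R) (x y c eps : R) :
  (forall t, Num.min x y <= t <= Num.max x y ->
     is_derive t (1 : R) g (dg t) /\ `|dg t - c| <= eps) ->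
  `|g y - g x - c * (y - x)| <= eps * `|y - x|.
Proof.
wlog xy : x y / x <= y.
  move=> H; case/orP: (le_total x y) => [xy|yx]; first exact: H.
  move=> Hg; rewrite -normrN distrC.
  rewrite (_ : - (g y - g x - c * (y - x)) = g x - g y - c * (x - y)); last by ring.
  by apply: H => // t; rewrite minC maxC; exact: Hg.
rewrite (min_idPl xy) (max_idPr xy) => Hg.
have [||z zxy ->] := @MVT_segment _ g dg x y xy.
- by move=> t; rewrite in_itv/= => /andP[/ltW xt /ltW ty]; have [] := Hg t; rewrite ?xt.
- apply: derivable_within_continuous => t; rewrite in_itv/= => /Hg[[]]; by [].
rewrite -mulrBl normrM ler_wpM2r//.
by move: zxy; rewrite in_itv/= => /Hg[].
Qed.

Section row_mean_value.
Context {R : realType} (N : nat).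
Local Notation V := 'rV[R]_N.

Lemma derive_line (f : V -> R) (m d : V) t : derivable f (m + t *: d) d ->
  is_derive t (1 : R) (fun s => f (m + s *: d)) ('D_d f (m + t *: d)).
Proof.
have E : (fun h : R => h^-1 *: (f (m + (h *: 1 + t) *: d) - f (m + t *: d))) =
    (fun h => h^-1 *: ((f \o shift (m + t *: d)) (h *: d) - f (m + t *: d))).
  apply/funext => h /=; congr (_ *: (f _ - _)).
  by rewrite scaler1 scalerDl addrCA addrC.
by move=> df; split; rewrite /derivable /derive /shift /= ?E.
Qed.

(** The corners of a walk from [p] to [q] that changes one coordinate at a time, so that each edge
    involves a single partial derivative. *)
Definition mix_row (p q : V) (j : nat) : V := \row_(k < N) if (k < j)%N then q 0 k else p 0 k.

Lemma mix_rowS (p q : V) (j : 'I_N) :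
  mix_row p q j.+1 = mix_row p q j + (q 0 j - p 0 j) *: delta_mx 0 j.
Proof.
apply/rowP => k; rewrite !mxE eqxx/= ltnS leq_eqVlt.
have [->|kj] := eqVneq k j; first by rewrite eqxx/= ltnn mulr1 addrC subrK.
by rewrite (negbTE (_ : (k : nat) != j)) ?mulr0 ?addr0.
Qed.

Lemma row_mean_value (f : V -> R) (u p q : V) (c : 'I_N -> R) (d eps : R) :
  (forall w, `|w - u| <= d -> forall k,
    derivable f w (delta_mx 0 k) /\ `|'D_(delta_mx 0 k) f w - c k| <= eps) ->
  `|p - u| <= d -> `|q - u| <= d ->
  `|f q - f p - \sum_(k < N) c k * (q - p) 0 k| <= N%:R * (eps * `|q - p|).
Proof.
move=> Hf pd qd; have d0 : 0 <= d by apply: le_trans pd.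
have step (j : 'I_N) : `|f (mix_row p q j.+1) - f (mix_row p q j) - c j * (q - p) 0 j| <= eps * `|q - p|.
  pose m := mix_row p q j.
  have eps0 : 0 <= eps by have [_] := Hf p pd j; exact: le_trans.
  have qpj : (q - p) 0 j = q 0 j - p 0 j by rewrite !mxE.
  apply: (@le_trans _ _ (eps * `|q 0 j - p 0 j|)); last first.
    by rewrite ler_wpM2l// -qpj rV_entry_le.
  rewrite qpj -[X in _ * `|X|]subr0 -[X in c j * X]subr0 mix_rowS.
  rewrite -[X in f X - _](_ : m + (q 0 j - p 0 j) *: delta_mx 0 j = _)//.
  rewrite -[X in _ - f X](_ : m + 0 *: delta_mx 0 j = _); last by rewrite scale0r addr0.
  apply: (@mean_value_bound _ (fun t => f (m + t *: delta_mx 0 j))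
    (fun t => 'D_(delta_mx 0 j) f (m + t *: delta_mx 0 j))) => t tpq.
  (* The norm is the maximum of the coordinates: each coordinate here is that of [p] or [q], except
     the [j]-th, which lies between the two, so the edge stays in the ball around [u]. *)
  have bd : `|m + t *: delta_mx 0 j - u| <= d.
    apply: rV_norm_le => // k.
    have pk : `|p 0 k - u 0 k| <= d.
      by apply: le_trans pd; have := rV_entry_le (p - u) k; rewrite !mxE.
    have qk : `|q 0 k - u 0 k| <= d.
      by apply: le_trans qd; have := rV_entry_le (q - u) k; rewrite !mxE.
    rewrite !mxE eqxx/=; have [kj|kj] := eqVneq k j; last first.
      by rewrite mulr0 addr0; case: ifP.
    rewrite kj ltnn mulr1; rewrite kj in pk qk.
    move: pk qk tpq; rewrite !ler_norml ge_min le_max => /andP[? ?] /andP[? ?].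
    by move=> /andP[/orP[?|?] /orP[?|?]]; apply/andP; split; lra.
  by have [df ?] := Hf _ bd j; split => //; exact: derive_line.
have mix0 : mix_row p q 0 = p by apply/rowP => k; rewrite mxE.
have mixN : mix_row p q N = q by apply/rowP => k; rewrite mxE ltn_ord.
have -> : f q - f p = \sum_(j < N) (f (mix_row p q j.+1) - f (mix_row p q j)).
  rewrite -[RHS](big_mkord xpredT (fun j => f (mix_row p q j.+1) - f (mix_row p q j))).
  by rewrite telescope_sumr// mix0 mixN.
rewrite -sumrB (le_trans (ler_norm_sum _ _ _))//.
rewrite (le_trans (ler_sum _ (fun j _ => step j)))//.
by rewrite sumr_const card_ord mulr_natl.
Qed.

End row_mean_value.

(* Uniformity in [x] comes from compactness of the curve [x |-> (x, Y x)]. *)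
Lemma near_curve_uniform (R : realType) (W : normedModType R) (a b : R)
    (g : R -> W -> R) (Y : R -> W) :
  {within [set p : R * W | p.1 \in `[a, b]], continuous (fun p => g p.1 p.2)} ->
  {within `[a, b], continuous Y} ->
  forall eps : R, 0 < eps -> \forall d \near 0^'+,
    forall x, x \in `[a, b] -> forall w, `|w - Y x| <= d ->
      `|g x w - g x (Y x)| <= eps.
Proof.
move=> /subspace_continuousP cg /subspace_continuousP cY eps eps0.
have := (compact_near_coveringP `[a, b]%classic).1 (@segment_compact _ a b).
move/near_covering_withinP.
move=> /(_ R (0^'+ : set_system R) (fun d x => forall w, `|w - Y x| <= d ->
      `|g x w - g x (Y x)| <= eps)).
move=> /(_ _ _) H; have {}H : \forall d \near (0:R)^'+, `[a, b] `<=` (fun x =>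
    forall w, `|w - Y x| <= d -> `|g x w - g x (Y x)| <= eps); last first.
  by apply: filterS H => d Hd x xab; apply: Hd.
apply: H => x xab.
have e2 : 0 < eps / 2 by rewrite divr_gt0.
have /cvgrPdist_lt/(_ _ e2) := cg (x, Y x) xab.
rewrite near_withinE => /nbhs_ballP[r /= r0 Hr].
have r2 : 0 < r / 2 by rewrite divr_gt0.
have /cvgrPdist_lt/(_ _ r2) := cY x xab.
rewrite near_withinE => /nbhs_ballP[s /= s0 Hs].
(* Two halves of [r]: [Y] moves by less than r / 2 for x' within [s] of [x], and [w] is within r / 2
   of [Y x'], so (x', w) stays in the ball of radius [r] around (x, Y x). *)
exists (ball x (Num.min r s), [set d | d < r / 2]) => /=.
  split; first by apply: nbhsx_ballx; rewrite lt_min r0.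
  by apply: nbhs_right_lt.
move=> [x' d] /= [xx' dr] x'ab w wd.
have rs1 : Num.min r s <= r by rewrite ge_min lexx.
have rs2 : Num.min r s <= s by rewrite ge_min lexx orbT.
have Yx' := Hs x' (lt_le_trans xx' rs2) x'ab.
have A1 : `|g x (Y x) - g x' w| < eps / 2.
  apply: (Hr (x', w)) => //; split => /=; first exact: lt_le_trans xx' rs1.
  rewrite -ball_normE/= (_ : Y x - w = (Y x - Y x') - (w - Y x')); last first.
    by rewrite opprB addrA subrK.
  by rewrite (le_lt_trans (ler_normB _ _))//; lra.
have A2 : `|g x (Y x) - g x' (Y x')| < eps / 2.
  apply: (Hr (x', Y x')) => //; split => /=; first exact: lt_le_trans xx' rs1.
  by rewrite -ball_normE/= (lt_trans Yx')// ltr_pdivrMr// ltr_pMr// ltr1n.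
rewrite distrC (_ : _ - _ = (g x (Y x) - g x' w) - (g x (Y x) - g x' (Y x'))); last by ring.
by rewrite (le_trans (ler_normB _ _))//; lra.
Qed.

Lemma within_continuous_comp (S T U : topologicalType) (A : set S) (B : set T)
    (f : T -> U) (phi : S -> T) :
  {within A, continuous phi} -> (forall x, A x -> B (phi x)) ->
  {within B, continuous f} -> {within A, continuous (f \o phi)}.
Proof.
move=> /subspace_continuousP cphi AB /subspace_continuousP cf.
apply/subspace_continuousP => x Ax.
apply: (@cvg_comp _ _ _ phi f _ (within B (nbhs (phi x)))); last exact: cf (AB _ Ax).
move=> P wP.
have H : \forall t \near within A (nbhs x), B (phi t) -> P (phi t) := cphi x Ax _ wP.
change (\forall t \near within A (nbhs x), P (phi t)).
move: H; rewrite !near_withinE; apply: filterS => t H At.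
by apply: H => //; exact: AB.
Qed.

(** * Increments of a Lagrangian along a continuous curve *)

Section lagrangian_along_curves.
Context {R : realType} (a b : R) (N : nat).
Hypothesis ab : a < b.
Local Notation V := 'rV[R]_N.
Local Notation W := (V * V * V)%type.
Local Notation leb := (@lebesgue_measure R).
Implicit Types (L : lagrangian R N) (Y Z H : R -> W).

Let leab : a <= b := ltW ab.

Definition lag L (x : R) (p : W) : R := L x p.1.1 p.1.2 p.2.

Definition dlag L (x : R) (p q : W) : R :=
  \sum_(k < N) lag (partial_u k L) x p * q.1.1 0 k +
  \sum_(k < N) lag (partial_v k L) x p * q.1.2 0 k +
  \sum_(k < N) lag (partial_w k L) x p * q.2 0 k.

Definition lag_integral L Y : R := \int[leb]_(x in `[a, b]) lag L x (Y x).

Definition dlag_integral L Y H : R := \int[leb]_(x in `[a, b]) dlag L x (Y x) (H x).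

Lemma lag_continuous L : continuous_lagrangian a b L ->
  {within [set p : R * W | p.1 \in `[a, b]], continuous (fun p => lag L p.1 p.2)}.
Proof.
pose phi (p : R * W) : R * V * V * V := (p.1, p.2.1.1, p.2.1.2, p.2.2).
move=> cL; apply: (@within_continuous_comp _ _ _ _ _ _ phi _ _ cL) => //.
apply: continuous_subspaceT => p.
have c1 : (fun p : R * W => p.1) @ p --> p.1 by exact: cvg_fst.
have c2 : (fun p : R * W => p.2) @ p --> p.2 by exact: cvg_snd.
have c21 : (fun p : R * W => p.2.1) @ p --> p.2.1 by apply: (cvg_comp _ _ c2); exact: cvg_fst.
have c22 : (fun p : R * W => p.2.2) @ p --> p.2.2 by apply: (cvg_comp _ _ c2); exact: cvg_snd.
have c211 : (fun p : R * W => p.2.1.1) @ p --> p.2.1.1 by apply: (cvg_comp _ _ c21); exact: cvg_fst.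
have c212 : (fun p : R * W => p.2.1.2) @ p --> p.2.1.2 by apply: (cvg_comp _ _ c21); exact: cvg_snd.
exact: (cvg_pair (cvg_pair (cvg_pair c1 c211) c212) c22).
Qed.

Lemma lag_curve_continuous L Y : continuous_lagrangian a b L ->
  {within `[a, b], continuous Y} -> {within `[a, b], continuous (fun x => lag L x (Y x))}.
Proof.
move=> /lag_continuous cL cY.
apply: (@within_continuous_comp _ _ _ _ _ _ (fun x => (x, Y x)) _ _ cL) => //.
have ci : {within `[a, b], continuous (@id R)} by apply: continuous_subspaceT => t; exact: cvg_id.
by move=> t; exact: (cvg_pair (ci t) (cY t)).
Qed.

Lemma curve_coord_continuous Y : {within `[a, b], continuous Y} ->
  forall k, [/\ {within `[a, b], continuous (fun x => (Y x).1.1 0 k)},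
                {within `[a, b], continuous (fun x => (Y x).1.2 0 k)} &
                {within `[a, b], continuous (fun x => (Y x).2 0 k)}].
Proof.
move=> cY k.
have c1 : {within `[a, b], continuous (fun x => (Y x).1)}.
  by move=> t; apply: (cvg_comp _ _ (cY t)); exact: cvg_fst.
have c2' : {within `[a, b], continuous (fun x => (Y x).2)}.
  by move=> t; apply: (cvg_comp _ _ (cY t)); exact: cvg_snd.
have c11 : {within `[a, b], continuous (fun x => (Y x).1.1)}.
  by move=> t; apply: (cvg_comp _ _ (c1 t)); exact: cvg_fst.
have c12 : {within `[a, b], continuous (fun x => (Y x).1.2)}.
  by move=> t; apply: (cvg_comp _ _ (c1 t)); exact: cvg_snd.
split.
- exact: (within_continuous_coord (k := k) c11).
- exact: (within_continuous_coord (k := k) c12).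
- exact: (within_continuous_coord (k := k) c2').
Qed.

Lemma within_continuous_sum (I : Type) (s : seq I) (f : I -> R -> R) :
  (forall k, {within `[a, b], continuous (f k)}) ->
  {within `[a, b], continuous (fun x => \sum_(k <- s) f k x)}.
Proof.
move=> cf; elim: s => [|k s IH].
  rewrite (_ : (fun x => _) = fun=> 0); last by apply/funext => t; rewrite big_nil.
  by move=> t; exact: cvg_cst.
rewrite (_ : (fun x => _) = (fun x => f k x + \sum_(k <- s) f k x)); last first.
  by apply/funext => t; rewrite big_cons.
exact: within_continuous_add.
Qed.

Lemma cont_Rintegral_sum (I : Type) (s : seq I) (f : I -> R -> R) :
  (forall k, {within `[a, b], continuous (f k)}) ->
  \int[leb]_(x in `[a, b]) (\sum_(k <- s) f k x) =
  \sum_(k <- s) \int[leb]_(x in `[a, b]) f k x.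
Proof.
move=> cf; elim: s => [|k s IH].
  rewrite big_nil -[RHS](Rintegral_set0 leb (fun=> 0)) /Rintegral !integral0_eq//.
  by move=> x _; rewrite big_nil.
rewrite big_cons -IH -cont_RintegralD//; last exact: within_continuous_sum.
by apply: eq_Rintegral => x _; rewrite big_cons.
Qed.

Definition C1_in_uvw L : Prop :=
  [/\ continuous_lagrangian a b L,
      (forall x u v w, x \in `[a, b] -> forall k : 'I_N,
        [/\ derivable (fun u' => L x u' v w) u (delta_mx 0 k),
            derivable (fun v' => L x u v' w) v (delta_mx 0 k) &
            derivable (fun w' => L x u v w') w (delta_mx 0 k)]) &
      forall k : 'I_N, [/\ continuous_lagrangian a b (partial_u k L),
                           continuous_lagrangian a b (partial_v k L) &
                           continuous_lagrangian a b (partial_w k L)]].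

Lemma C1_lagrangian_uvw L : C1_lagrangian a b L -> C1_in_uvw L.
Proof. by case=> cL dL _ cp; split => // x u v w /(dL x u v w)[]. Qed.

Lemma dlag_curve_continuous L Y H : C1_in_uvw L ->
  {within `[a, b], continuous Y} -> {within `[a, b], continuous H} ->
  {within `[a, b], continuous (fun x => dlag L x (Y x) (H x))}.
Proof.
move=> [_ _ cp] cY cH; have cHk := curve_coord_continuous cH.
apply: within_continuous_add; first apply: within_continuous_add;
  apply: within_continuous_sum => k; apply: within_continuous_mul;
  have [? ? ?] := cHk k; have [? ? ?] := cp k => //; exact: lag_curve_continuous.
Qed.

Lemma dlag_ZD L x p q q' c : dlag L x p (q + c *: q') = dlag L x p q + c * dlag L x p q'.
Proof.
rewrite /dlag !mulrDr !mulr_sumr.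
have aux (l : 'I_N -> R) (u u' : V) : \sum_(k < N) l k * (u + c *: u') 0 k =
    \sum_(k < N) l k * u 0 k + \sum_(k < N) c * (l k * u' 0 k).
  by rewrite -big_split; apply: eq_bigr => k _ /=; rewrite !mxE; ring.
rewrite !aux; ring.
Qed.

Lemma dlag_integral_ZD L Y H H' c : C1_in_uvw L -> {within `[a, b], continuous Y} ->
  {within `[a, b], continuous H} -> {within `[a, b], continuous H'} ->
  dlag_integral L Y (fun x => H x + c *: H' x) =
  dlag_integral L Y H + c * dlag_integral L Y H'.
Proof.
move=> cL cY cH cH'; rewrite /dlag_integral.
have C1 := dlag_curve_continuous cL cY cH.
have C2 := dlag_curve_continuous cL cY cH'.
rewrite -cont_RintegralZ// -cont_RintegralD//; last exact: within_continuous_scale.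
by apply: eq_Rintegral => x _; rewrite dlag_ZD.
Qed.

Lemma eq_dlag_integral L Y H H' : (forall x, x \in `[a, b] -> H x = H' x) ->
  dlag_integral L Y H = dlag_integral L Y H'.
Proof. by move=> HH'; apply: eq_Rintegral => x; rewrite inE => xab; rewrite HH'. Qed.

Lemma eq_lag_integral L Y Z : (forall x, x \in `[a, b] -> Y x = Z x) ->
  lag_integral L Y = lag_integral L Z.
Proof. by move=> YZ; apply: eq_Rintegral => x; rewrite inE => xab; rewrite YZ. Qed.

Lemma curve_continuous_ZD (H H' : R -> W) (c : R) : {within `[a, b], continuous H} ->
  {within `[a, b], continuous H'} ->
  {within `[a, b], continuous (fun x => H x + c *: H' x)}.
Proof. by move=> cH cH' t; exact: (cvgD (cH t) (cvgZl_tmp (k := c) (cH' t))). Qed.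

Lemma curve_sum (I : Type) (s : seq I) (c : I -> R) (Hs : I -> R -> W) H :
  {within `[a, b], continuous H} -> (forall l, {within `[a, b], continuous (Hs l)}) ->
  {within `[a, b], continuous (fun x => H x + \sum_(l <- s) c l *: Hs l x)} /\
  (forall L Y, C1_in_uvw L -> {within `[a, b], continuous Y} ->
    dlag_integral L Y (fun x => H x + \sum_(l <- s) c l *: Hs l x) =
    dlag_integral L Y H + \sum_(l <- s) c l * dlag_integral L Y (Hs l)).
Proof.
move=> cH cHs; elim: s => [|l s [IHc IHd]].
  rewrite (_ : (fun x => _) = H); last by apply/funext => x; rewrite big_nil addr0.
  by split => // L Y _ _; rewrite big_nil addr0.
rewrite (_ : (fun x => _) = (fun x => H x + \sum_(l <- s) c l *: Hs l x + c l *: Hs l x)); last first.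
  by apply/funext => x; rewrite big_cons -addrA (addrC (c l *: _)).
split; first exact: curve_continuous_ZD.
move=> L Y cL cY; rewrite dlag_integral_ZD// IHd// big_cons.
by rewrite -addrA (addrC (c l * _)).
Qed.

Lemma triple_norm_le (p : W) (d : R) :
  (`|p| <= d) = [&& `|p.1.1| <= d, `|p.1.2| <= d & `|p.2| <= d].
Proof. by case: p => [[u v] w]; rewrite !prod_normE/= !ge_max andbA. Qed.

Lemma lag_increment L (x d e : R) (c p q : W) : C1_in_uvw L -> x \in `[a, b] -> 0 <= e ->
  (forall (k : 'I_N) (w : W), `|w - c| <= d -> [/\
    `|lag (partial_u k L) x w - lag (partial_u k L) x c| <= e,
    `|lag (partial_v k L) x w - lag (partial_v k L) x c| <= e &
    `|lag (partial_w k L) x w - lag (partial_w k L) x c| <= e]) ->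
  `|p - c| <= d -> `|q - c| <= d ->
  `|lag L x q - lag L x p - dlag L x c (q - p)| <= 3 * (N%:R * (e * `|q - p|)).
Proof.
move=> [_ dL _] xab e0.
case: p q => [[p1 p2] p3] [[q1 q2] q3] Hd.
rewrite !triple_norm_le => /and3P[/= p1d p2d p3d] /and3P[/= q1d q2d q3d].
set M := (X in e * X).
have /and3P[/= M1 M2 M3] : [&& `|q1 - p1| <= M, `|q2 - p2| <= M & `|q3 - p3| <= M].
  by rewrite -(triple_norm_le ((q1, q2, q3) - (p1, p2, p3) : W)).
have bnd m : m <= M -> N%:R * (e * m) <= N%:R * (e * M).
  by move=> mM; rewrite ler_wpM2l// ler_wpM2l.
have E1 : `|L x q1 q2 q3 - L x p1 q2 q3 -
    \sum_(k < N) lag (partial_u k L) x c * (q1 - p1) 0 k| <= N%:R * (e * M).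
  apply: le_trans (bnd _ M1).
  apply: (@row_mean_value _ _ (fun u => L x u q2 q3) c.1.1 _ _
    (fun k => lag (partial_u k L) x c) d e) => // w wd k.
  split; first exact: (let: And3 h _ _ := dL x w q2 q3 xab k in h).
  by have [] := Hd k (w, q2, q3); rewrite ?triple_norm_le /= ?wd ?q2d ?q3d.
have E2 : `|L x p1 q2 q3 - L x p1 p2 q3 -
    \sum_(k < N) lag (partial_v k L) x c * (q2 - p2) 0 k| <= N%:R * (e * M).
  apply: le_trans (bnd _ M2).
  apply: (@row_mean_value _ _ (fun v => L x p1 v q3) c.1.2 _ _
    (fun k => lag (partial_v k L) x c) d e) => // w wd k.
  split; first exact: (let: And3 _ h _ := dL x p1 w q3 xab k in h).
  by have [] := Hd k (p1, w, q3); rewrite ?triple_norm_le /= ?wd ?p1d ?q3d.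
have E3 : `|L x p1 p2 q3 - L x p1 p2 p3 -
    \sum_(k < N) lag (partial_w k L) x c * (q3 - p3) 0 k| <= N%:R * (e * M).
  apply: le_trans (bnd _ M3).
  apply: (@row_mean_value _ _ (fun w => L x p1 p2 w) c.2 _ _
    (fun k => lag (partial_w k L) x c) d e) => // w wd k.
  split; first exact: (let: And3 _ _ h := dL x p1 p2 w xab k in h).
  by have [] := Hd k (p1, p2, w); rewrite ?triple_norm_le /= ?wd ?p1d ?p2d.
rewrite /dlag {1 2}/lag /=.
move: E1 E2 E3.
set s1 := \sum_(k < N) _; set s2 := \sum_(k < N) _; set s3 := \sum_(k < N) _ => E1 E2 E3.
rewrite (_ : L x q1 q2 q3 - L x p1 p2 p3 - _ = (L x q1 q2 q3 - L x p1 q2 q3 - s1) +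
  (L x p1 q2 q3 - L x p1 p2 q3 - s2) + (L x p1 p2 q3 - L x p1 p2 p3 - s3)); last by ring.
rewrite (le_trans (ler_normD _ _))// (le_trans (lerD (ler_normD _ _) (lexx _)))//.
by have := lerD (lerD E1 E2) E3; lra.
Qed.

Lemma lag_strict L Y (eps : R) : C1_in_uvw L -> {within `[a, b], continuous Y} -> 0 < eps ->
  \forall d \near 0^'+, forall x, x \in `[a, b] -> forall p q : W,
    `|p - Y x| <= d -> `|q - Y x| <= d ->
    `|lag L x q - lag L x p - dlag L x (Y x) (q - p)| <= eps * `|q - p|.
Proof.
move=> cL cY eps0; have [_ _ cp] := cL.
(* It absorbs the factor 3 N of [lag_increment]; the [+ 1] keeps the denominator positive when
   [N = 0]. *)
pose e := eps / (3 * N%:R + 1).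
have D0 : 0 < 3 * N%:R + 1 :> R by rewrite ltr_wpDl// mulr_ge0.
have e0 : 0 < e by rewrite divr_gt0.
have nearP (Pk : 'I_N -> lagrangian R N) : (forall k, continuous_lagrangian a b (Pk k)) ->
    \forall d \near (0:R)^'+, forall k x, x \in `[a, b] -> forall w : W, `|w - Y x| <= d ->
      `|lag (Pk k) x w - lag (Pk k) x (Y x)| <= e.
  move=> cPk; apply: filter_forall => k.
  exact: (near_curve_uniform (lag_continuous (cPk k)) cY e0).
have nu := nearP (fun k => partial_u k L) (fun k => let: And3 h _ _ := cp k in h).
have nv := nearP (fun k => partial_v k L) (fun k => let: And3 _ h _ := cp k in h).
have nw := nearP (fun k => partial_w k L) (fun k => let: And3 _ _ h := cp k in h).
apply: filterS3 nu nv nw => d Hu Hv Hw x xab p q pd qd.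
apply: le_trans (lag_increment cL xab (ltW e0) _ pd qd) _.
  by move=> k w wd; split; [exact: Hu|exact: Hv|exact: Hw].
rewrite (_ : 3 * _ = (3 * N%:R) * e * `|q - p|); last by ring.
by rewrite ler_wpM2r// /e mulrCA ger_pMr// ler_pdivrMr// mul1r lerDl.
Qed.

Lemma lag_integral_strict L Y (eps : R) : C1_in_uvw L -> {within `[a, b], continuous Y} -> 0 < eps ->
  \forall d \near 0^'+, forall Z Z' (B : R),
    {within `[a, b], continuous Z} -> {within `[a, b], continuous Z'} ->
    (forall x, x \in `[a, b] -> `|Z x - Y x| <= d) ->
    (forall x, x \in `[a, b] -> `|Z' x - Y x| <= d) ->
    (forall x, x \in `[a, b] -> `|Z' x - Z x| <= B) ->
    `|lag_integral L Z' - lag_integral L Z - dlag_integral L Y (fun x => Z' x - Z x)| <=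
    eps * B.
Proof.
move=> cL cY eps0; have ba0 : 0 < b - a by rewrite subr_gt0.
have e0 : 0 < eps / (b - a) by rewrite divr_gt0.
have := lag_strict cL cY e0; apply: filterS => d Hd Z Z' B cZ cZ' Zd Z'd ZB.
have [cL0 _ _] := cL.
have cZZ : {within `[a, b], continuous (fun x => Z' x - Z x)}.
  by move=> t; exact: (cvgB (cZ' t) (cZ t)).
have C1 := lag_curve_continuous cL0 cZ; have C2 := lag_curve_continuous cL0 cZ'.
have C3 := dlag_curve_continuous cL cY cZZ.
rewrite /lag_integral /dlag_integral -(cont_RintegralB C2 C1).
rewrite -(cont_RintegralB (within_continuous_sub C2 C1) C3).
apply: (le_trans (@cont_norm_Rintegral_le _ a b _ (eps / (b - a) * B) leab _ _)).
- exact: within_continuous_sub (within_continuous_sub C2 C1) C3.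
- move=> x xab; apply: (le_trans (Hd x xab _ _ (Zd x xab) (Z'd x xab))).
  by rewrite ler_wpM2l ?(ltW e0)// ZB.
- by rewrite mulrAC divfK// gt_eqF.
Qed.

End lagrangian_along_curves.

(** * Finite-dimensional families of curves *)

Section families.
Context {R : realType} (a b : R) (N r : nat).
Hypothesis ab : a < b.
Local Notation V := 'rV[R]_N.
Local Notation W := (V * V * V)%type.
Variables (Y H : R -> W) (Hs : 'I_r -> R -> W).
Hypothesis cY : {within `[a, b], continuous Y}.
Hypothesis cH : {within `[a, b], continuous H}.
Hypothesis cHs : forall l, {within `[a, b], continuous (Hs l)}.

Definition curve (t : R) (c : 'rV[R]_r) (x : R) : W :=
  Y x + t *: H x + \sum_(l < r) c 0 l *: Hs l x.

Lemma curve00 x : curve 0 0 x = Y x.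
Proof. by rewrite /curve scale0r addr0 big1 ?addr0// => l _; rewrite mxE scale0r. Qed.

Lemma curve_continuous t c : {within `[a, b], continuous (curve t c)}.
Proof.
have [cC _] := curve_sum (index_enum _) (fun l => c 0 l)
  (curve_continuous_ZD (c := t) cY cH) cHs.
exact: cC.
Qed.

Lemma curveB t t' c c' x :
  curve t' c' x - curve t c x = (t' - t) *: H x + \sum_(l < r) (c' - c) 0 l *: Hs l x.
Proof.
rewrite /curve opprD addrACA; congr (_ + _).
  by rewrite opprD addrACA subrr add0r -scalerBl.
by rewrite -sumrB; apply: eq_bigr => l _; rewrite -scalerBl !mxE.
Qed.

Lemma curve_bound : exists2 M : R, 0 < M & forall t t' c c' x, x \in `[a, b] ->
  `|curve t' c' x - curve t c x| <= M * (`|t' - t| + `|c' - c|).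
Proof.
have [M1 M10 HM1] := itv_bounded cH.
have cS : {within `[a, b], continuous (fun x => \sum_(l < r) `|Hs l x|)}.
  apply: within_continuous_sum => l t.
  by apply: cvg_norm; exact: cHs.
have [M2 M20 HM2] := itv_bounded cS.
exists (M1 + M2); first exact: addr_gt0.
move=> t t' c c' x xab; rewrite curveB (le_trans (ler_normD _ _))//.
have n1 := normr_ge0 (t' - t); have n2 := normr_ge0 (c' - c).
have A1 : `|(t' - t) *: H x| <= M1 * `|t' - t|.
  by rewrite normrZ mulrC ler_wpM2r// HM1.
have A2 : `|\sum_(l < r) (c' - c) 0 l *: Hs l x| <= M2 * `|c' - c|.
  rewrite (le_trans (ler_norm_sum _ _ _))//.
  apply: (@le_trans _ _ (\sum_(l < r) `|Hs l x| * `|c' - c|)).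
    by apply: ler_sum => l _; rewrite normrZ mulrC ler_wpM2l// rV_entry_le.
  rewrite -mulr_suml ler_wpM2r//.
  by apply: le_trans (HM2 _ xab); rewrite ler_norm.
by rewrite (le_trans (lerD A1 A2))// mulrDl !mulrDr; nra.
Qed.

Lemma lag_integral_curve_strict (L : lagrangian R N) (eps : R) : C1_in_uvw a b L -> 0 < eps ->
  exists2 d : R, 0 < d & forall t t' c c',
    `|t| <= d -> `|t'| <= d -> `|c| <= d -> `|c'| <= d ->
    `|lag_integral a b L (curve t' c') - lag_integral a b L (curve t c) -
      ((t' - t) * dlag_integral a b L Y H +
       \sum_(l < r) dlag_integral a b L Y (Hs l) * (c' - c) 0 l)| <=
    eps * (`|t' - t| + `|c' - c|).
Proof.
move=> cL eps0; have [M M0 HM] := curve_bound.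
have e0 : 0 < eps / M by rewrite divr_gt0.
have nd := lag_integral_strict ab cL cY e0.
have [d [d0 Hd]] := filter_ex (filterI (nbhs_right_gt (0 : R)) nd).
have dM : 0 < d / (2 * M) by rewrite divr_gt0// mulr_gt0.
(* The curve moves by at most M (|t| + |c|), and each of the two terms gets half of [d]. *)
exists (d / (2 * M)) => // t t' c c' td t'd cd c'd.
have near0 s e : `|s| <= d / (2 * M) -> `|e| <= d / (2 * M) ->
    forall x, x \in `[a, b] -> `|curve s e x - Y x| <= d.
  move=> sd ed x xab; rewrite -(curve00 x) (le_trans (HM _ _ _ _ _ xab))// !subr0.
  apply: (@le_trans _ _ (M * (d / (2 * M) + d / (2 * M)))).
    by rewrite ler_wpM2l ?(ltW M0)// lerD.
  rewrite le_eqVlt; apply/orP; left; apply/eqP; field; exact: lt0r_neq0.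
have := Hd _ _ _ (@curve_continuous t c) (@curve_continuous t' c') (near0 _ _ td cd)
  (near0 _ _ t'd c'd) (fun x xab => HM t t' c c' x xab).
rewrite mulrA divfK ?gt_eqF//.
(* The linearity lemmas start from a term with coefficient 1, hence [(t' - t) *: H] is read as
   [H + (t' - t - 1) *: H]. *)
have [_ /(_ L Y cL cY) E] := curve_sum (index_enum _) (fun l => (c' - c) 0 l)
  (curve_continuous_ZD (c := t' - t - 1) cH cH) cHs.
have E1 := dlag_integral_ZD (t' - t - 1) cL cY cH cH.
rewrite (_ : dlag_integral a b L Y (fun x => curve t' c' x - curve t c x) =
  (t' - t) * dlag_integral a b L Y H +
  \sum_(l < r) dlag_integral a b L Y (Hs l) * (c' - c) 0 l)//.
transitivity (dlag_integral a b L Y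
  (fun x => H x + (t' - t - 1) *: H x + \sum_(l < r) (c' - c) 0 l *: Hs l x)).
  apply: eq_dlag_integral => x _; rewrite curveB; congr (_ + _).
  by rewrite [in RHS]scalerBl scale1r [RHS]addrC subrK.
rewrite E E1; congr (_ + _); first by ring.
by apply: eq_bigr => l _; rewrite mulrC.
Qed.

End families.

(** * First variations, the norm of D, and admissible directions *)

Section variations.
Context {R : realType} (a b alpha beta gamma : R) (N : nat).
Hypothesis ab : a < b.
Hypothesis alpha01 : 0 < alpha < 1.
Hypothesis beta01 : 0 < beta < 1.
Local Notation V := 'rV[R]_N.
Local Notation W := (V * V * V)%type.
Local Notation D := (in_D a b alpha beta gamma).
Local Notation jet := (jet a b alpha beta gamma).
Local Notation J L := (functional a b alpha beta gamma L).

Lemma functionalE (L : lagrangian R N) z : J L z = lag_integral a b L (jet z).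
Proof. by []. Qed.

Lemma first_variationE (L : lagrangian R N) y h : C1_in_uvw a b L -> D y -> D h ->
  first_variation (J L) y h = dlag_integral a b L (jet y) (jet h).
Proof.
move=> cL yD hD; apply: cvg_lim => //.
set v := dlag_integral _ _ _ _ _.
have cY := jet_continuous yD; have cH := jet_continuous hD.
apply/cvgrPdist_le => e e0.
(* With [r = 0] the family reduces to the line y + t h, and the strict estimate between 0 and [t]
   bounds the variation quotient. *)
have [d d0 Hd] := lag_integral_curve_strict (r := 0) ab cY cH
  (Hs := fun _ => jet h) (fun=> cH) cL e0.
near=> t.
have t0 : t != 0 by near: t; exact: nbhs_dnbhs_neq.
have td : `|t| <= d by near: t; apply: dnbhs0_le.
have d0' : `|0 : 'rV[R]_0| <= d by rewrite normr0 ltW.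
have d0'' : `|0 : R| <= d by rewrite normr0 ltW.
have := Hd 0 t 0 0 d0'' td d0' d0'.
rewrite !subr0 big_ord0 addr0 normr0 addr0 -/v.
rewrite (_ : lag_integral a b L (curve _ _ _ t 0) = J L (fun x => y x + t *: h x)); last first.
  rewrite functionalE; apply: eq_lag_integral => x xab.
  by rewrite jet_ZD// /curve big_ord0 addr0.
rewrite (_ : lag_integral a b L (curve _ _ _ 0 0) = J L y); last first.
  by rewrite functionalE; apply: eq_lag_integral => x _; exact: curve00.
move=> Ht; rewrite distrC /variation_quot -[X in _ / t - X](mulfK t0) -mulrBl normrM normfV.
by rewrite ler_pdivrMr ?normr_gt0// (mulrC v).
Unshelve. all: by end_near. Qed.

(** Expanding [u] in the basis bounds the given norm by the maximum norm. This puts curves with a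
    small jet into the neighborhood of [y] in which it is minimal. *)
Lemma norm_le_coord (nrm : V -> R) : is_norm nrm ->
  exists2 K : R, 0 <= K & forall u, nrm u <= K * `|u|.
Proof.
move=> [n0 _ nZ nD]; exists (\sum_(k < N) nrm (delta_mx 0 k)).
  by apply: sumr_ge0.
move=> u; rewrite {1}(row_sum_delta u).
apply: (@le_trans _ _ (\sum_(k < N) nrm (u 0 k *: delta_mx 0 k))).
  elim/big_ind2: _ => //.
    by rewrite -(scale0r (0 : V)) nZ normr0 mul0r.
  by move=> x1 x2 y1 y2 h1 h2; rewrite (le_trans (nD _ _))// lerD.
rewrite mulr_suml; apply: ler_sum => k _.
by rewrite nZ mulrC ler_wpM2l// rV_entry_le.
Qed.

Lemma norm1inf_le (nrm : V -> R) K z m : (forall u, nrm u <= K * `|u|) -> 0 <= K ->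
  (forall x, x \in `[a, b] -> `|jet z x| <= m) ->
  norm1inf a b alpha beta gamma nrm z <= 3 * (K * m).
Proof.
move=> nK K0 zm.
have bnd (f : R -> V) : (forall x, x \in `[a, b] -> `|f x| <= m) ->
    max_norm_on a b nrm f <= K * m.
  move=> fm; apply: ge_sup.
    by exists (nrm (f a)); exists a => //=; rewrite in_itv/= lexx ltW.
  move=> _ [x xab <-]; apply: le_trans (nK _) _.
  by rewrite ler_wpM2l// fm.
have h x : x \in `[a, b] -> [&& `|z x| <= m, `|derive_on a b z x| <= m &
    `|caputo_comb a b alpha beta gamma z x| <= m].
  by move=> xab; rewrite -(triple_norm_le (jet z x)) zm.
have B1 := bnd z (fun x xab => let: And3 h _ _ := and3P (h x xab) in h).
have B2 := bnd _ (fun x xab => let: And3 _ h _ := and3P (h x xab) in h).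
have B3 := bnd _ (fun x xab => let: And3 _ _ h := and3P (h x xab) in h).
by rewrite /norm1inf (_ : 3 * _ = K * m + K * m + K * m) ?lerD//; ring.
Qed.

Lemma admissible_direction_sum (I : Type) (s : seq I) (c : I -> R) (h : R -> V)
    (hs : I -> R -> V) :
  admissible_direction a b alpha beta gamma h ->
  (forall l, admissible_direction a b alpha beta gamma (hs l)) ->
  admissible_direction a b alpha beta gamma (fun x => h x + \sum_(l <- s) c l *: hs l x).
Proof.
move=> [hD ha hb] hsA; split.
- by apply: (in_D_jet_sum ab alpha01 beta01 s c hD _).1 => l; have [] := hsA l.
- by rewrite ha add0r big1// => l _; have [_ -> _] := hsA l; rewrite scaler0.
- by rewrite hb add0r big1// => l _; have [_ _ ->] := hsA l; rewrite scaler0.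
Qed.

(** Zero is [y - y], so closure of D under linear combinations suffices. It serves as the base term
    of the dual directions, which are pure sums. *)
Lemma admissible_direction0 (y : R -> V) : D y -> admissible_direction a b alpha beta gamma (fun=> 0 : V).
Proof.
move=> yD; have E : (fun=> 0 : V) = (fun x => y x + (-1) *: y x).
  by apply/funext => x; rewrite scaleN1r subrr.
split; [rewrite E|by []|by []].
exact: (in_D_ZD ab alpha01 beta01 (-1) yD yD).
Qed.

Lemma jet0 (y : R -> V) x : D y -> x \in `[a, b] -> jet (fun=> 0 : V) x = 0.
Proof.
move=> yD xab; have E : (fun=> 0 : V) = (fun x => y x + (-1) *: y x).
  by apply/funext => u; rewrite scaleN1r subrr.
rewrite E (jet_ZD ab alpha01 beta01 (-1) yD yD xab).
by rewrite scaleN1r subrr.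
Qed.

Lemma dlag_integral_jet0 (L : lagrangian R N) y : D y ->
  dlag_integral a b L (jet y) (jet (fun=> 0 : V)) = 0.
Proof.
move=> yD; rewrite (eq_dlag_integral L (jet y) (H' := fun=> 0)); last first.
  by move=> x xab; exact: jet0 yD xab.
rewrite /dlag_integral -[RHS](Rintegral_set0 (@lebesgue_measure R) (fun=> 0)).
rewrite /Rintegral !integral0_eq// => x _.
by rewrite /dlag !big1 ?addr0// => k _; rewrite mxE mulr0.
Qed.

Lemma dlag_integral_jet_sum (L : lagrangian R N) y (I : Type) (s : seq I) (c : I -> R)
    (h : R -> V) (hs : I -> R -> V) :
  C1_in_uvw a b L -> D y -> D h -> (forall l, D (hs l)) ->
  dlag_integral a b L (jet y) (jet (fun x => h x + \sum_(l <- s) c l *: hs l x)) =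
  dlag_integral a b L (jet y) (jet h) +
  \sum_(l <- s) c l * dlag_integral a b L (jet y) (jet (hs l)).
Proof.
move=> cL yD hD hsD.
have [_ E] := in_D_jet_sum ab alpha01 beta01 s c hD hsD.
have [_ /(_ L _ cL (jet_continuous yD)) E'] :=
  curve_sum s c (jet_continuous hD) (fun l => jet_continuous (hsD l)).
by rewrite -E'; exact: eq_dlag_integral.
Qed.

End variations.

(** * Lagrange multipliers and the Euler-Lagrange equations *)

(** Monotonicity turns each radius into an event near 0 from the right, and finitely many such
    events intersect; no minimum over a possibly empty index set is formed. *)
Lemma common_radius (R : realType) (r : nat) (P : 'I_r -> R -> Prop) :
  (forall j d d', d' <= d -> P j d -> P j d') ->
  (forall j, exists2 d : R, 0 < d & P j d) ->
  exists2 d : R, 0 < d & forall j, P j d.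
Proof.
move=> Pmono Pex.
have H : \forall d \near (0:R)^'+, forall j, P j d.
  apply: filter_forall => j; have [d d0 Pd] := Pex j.
  by apply: filterS (nbhs_right_le d0) => d' d'd; exact: Pmono d'd Pd.
by have [d [d0 Pd]] := filter_ex (filterI (nbhs_right_gt (0 : R)) H); exists d.
Qed.

(** The estimates of [multiplier_rule] are slices of the strict ones: [t = t'] gives the
    contraction, [c = c' = 0] gives the constraint error o(t), and the base point at the origin
    gives the expansion of [Psi]. The term (c' - c)_j encodes dual directions and a vanishing
    derivative in [t]. *)
Lemma multiplier_rule_components (R : realType) (r : nat)
    (Phi : 'I_r -> R -> 'rV[R]_r -> R) (Psi : R -> 'rV[R]_r -> R)
    (v : R) (lam : 'I_r -> R) :
  (forall j (eps : R), 0 < eps -> exists2 d : R, 0 < d & forall t t' c c',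
    `|t| <= d -> `|t'| <= d -> `|c| <= d -> `|c'| <= d ->
    `|Phi j t' c' - Phi j t c - (c' - c) 0 j| <= eps * (`|t' - t| + `|c' - c|)) ->
  (forall eps : R, 0 < eps -> exists2 d : R, 0 < d & forall t t' c c',
    `|t| <= d -> `|t'| <= d -> `|c| <= d -> `|c'| <= d ->
    `|Psi t' c' - Psi t c - ((t' - t) * v + \sum_(l < r) lam l * (c' - c) 0 l)| <=
    eps * (`|t' - t| + `|c' - c|)) ->
  (exists2 d : R, 0 < d & forall t c, `|t| <= d -> `|c| <= d ->
    (forall j, Phi j t c = Phi j 0 0) -> Psi 0 0 <= Psi t c) ->
  v = 0.
Proof.
move=> HPhi HPsi [d0 d0_gt0 Hmin].
have Gstrict (eps : R) : 0 < eps -> exists2 d : R, 0 < d & forall j t t' c c',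
    `|t| <= d -> `|t'| <= d -> `|c| <= d -> `|c'| <= d ->
    `|Phi j t' c' - Phi j t c - (c' - c) 0 j| <= eps * (`|t' - t| + `|c' - c|).
  move=> eps0; apply: common_radius => j; last exact: HPhi.
  move=> d d' d'd H t t' c c' td t'd cd c'd.
  by apply: H; [exact: le_trans td d'd|exact: le_trans t'd d'd|
                exact: le_trans cd d'd|exact: le_trans c'd d'd].
have norm0 (d : R) : 0 < d -> `|0 : R| <= d /\ `|0 : 'rV[R]_r| <= d.
  by move=> d_gt0; rewrite !normr0 ltW.
apply: (@multiplier_rule R r (fun t c => \row_j Phi j t c) Psi _ lam).
- move=> eps eps0; have [d d_gt0 Hd] := Gstrict _ eps0.
  exists d => // t c c' td cd c'd; apply: rV_norm_le => [|j].
    by rewrite mulr_ge0// ltW.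
  have := Hd j t t c c' td td cd c'd; rewrite subrr normr0 add0r.
  by rewrite !mxE.
- move=> eps eps0; have [d d_gt0 Hd] := Gstrict _ eps0.
  have [n1 n2] := norm0 _ d_gt0.
  exists d => // t td; apply: rV_norm_le => [|j].
    by rewrite mulr_ge0// ltW.
  have := Hd j 0 t 0 0 n1 td n2 n2; rewrite !subr0 normr0 addr0.
  by rewrite !mxE subr0.
- move=> eps eps0; have [d d_gt0 Hd] := HPsi _ eps0.
  have [n1 n2] := norm0 _ d_gt0.
  exists d => // t c td cd.
  by have := Hd 0 t 0 c n1 td n2 cd; rewrite !subr0.
exists d0 => // t c td cd FE; apply: Hmin => // j.
by move/rowP: FE => /(_ j); rewrite !mxE.
Qed.

Lemma sum_delta_row (R : realType) (r : nat) (f : 'I_r -> R) (u : 'rV[R]_r) (s v : R) j :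
  v = 0 -> (forall l, f l = (j == l)%:R) ->
  s * v + \sum_(l < r) f l * u 0 l = u 0 j.
Proof.
move=> -> fE; rewrite mulr0 add0r (bigD1 j)//= fE eqxx mul1r big1 ?addr0// => l lj.
by rewrite fE eq_sym (negbTE lj) mul0r.
Qed.

Lemma sum_delta_sub (R : realType) (r : nat) (v f : 'I_r -> R) j :
  (forall m, f m = (j == m)%:R) -> v j + \sum_(m < r) - v m * f m = 0.
Proof.
move=> fE; rewrite (bigD1 j)//= fE eqxx mulr1 big1 ?addr0 ?subrr// => m mj.
by rewrite fE eq_sym (negbTE mj) mulr0.
Qed.

Lemma sum_mulN (R : realType) (r : nat) (f v : 'I_r -> R) :
  - (\sum_(m < r) f m * v m) = \sum_(m < r) - v m * f m.
Proof. by rewrite -sumrN; apply: eq_bigr => m _; rewrite mulNr mulrC. Qed.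

Section multipliers.
Context {R : realType} (a b : R) (N r : nat) (alpha beta gamma : R).
Local Notation V := 'rV[R]_N.
Variables (nrm : V -> R) (L : lagrangian R N) (G : 'I_r -> lagrangian R N).
Variables (ya yb : V) (xi : 'I_r -> R) (y : R -> V).
Hypothesis ab : a < b.
Hypothesis alpha01 : 0 < alpha < 1.
Hypothesis beta01 : 0 < beta < 1.
Hypothesis nrm_norm : is_norm nrm.
Hypothesis cL : C1_in_uvw a b L.
Hypothesis cG : forall j, C1_in_uvw a b (G j).
Hypothesis y_min : local_minimizer a b alpha beta gamma nrm L G ya yb xi y.
Local Notation D := (in_D a b alpha beta gamma).
Local Notation jet := (jet a b alpha beta gamma).
Local Notation adm := (admissible_direction a b alpha beta gamma).
Local Notation var M h := (dlag_integral a b M (jet y) (jet h)).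

Let yD : D y. Proof. by case: y_min => [[]]. Qed.

Lemma variation_eq0 (h : R -> V) (hs : 'I_r -> R -> V) :
  adm h -> (forall l, adm (hs l)) ->
  (forall j, var (G j) h = 0) ->
  (forall j l, var (G j) (hs l) = (j == l)%:R) ->
  var L h = 0.
Proof.
move=> hA hsA Gh Ghs.
have [[_ ya_ yb_ Gy] [delta delta0 ymin]] := y_min.
have hD : D h by case: hA.
have hsD l : D (hs l) by case: (hsA l).
have cY := jet_continuous yD; have cH := jet_continuous hD.
have cHs l := jet_continuous (hsD l).
pose Z := curve (jet y) (jet h) (fun l => jet (hs l)).
apply: (@multiplier_rule_components R r (fun j t c => lag_integral a b (G j) (Z t c))
  (fun t c => lag_integral a b L (Z t c)) _ (fun l => var L (hs l))).
- move=> j eps eps0.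
  have [d d0 Hd] := lag_integral_curve_strict ab cY cH cHs (cG j) eps0.
  exists d => // t t' c c' td t'd cd c'd.
  rewrite -(sum_delta_row (c' - c) (t' - t) (Gh j) (Ghs j)).
  exact: Hd.
- exact: (fun eps => @lag_integral_curve_strict _ a b N r ab _ _ _ cY cH cHs L eps cL).
have [K K0 nK] := norm_le_coord nrm_norm.
have [M M0 HM] := curve_bound (jet y) cH cHs.
(* The distance from z to [y] is at most 3 K M (|t| + |c|), with |t| + |c| at most twice the radius.
   The [+ 1] makes the final bound strictly less than [delta] and covers [K = 0]. *)
have C0 : 0 < 6 * K * M + 1 by rewrite ltr_wpDl// mulr_ge0 ?mulr_ge0// ltW.
exists (delta / (6 * K * M + 1)); first exact: divr_gt0.
move=> t c td cd FE.
have ythD : D (fun x => y x + t *: h x) := in_D_ZD ab alpha01 beta01 t yD hD.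
pose z x := y x + t *: h x + \sum_(l < r) c 0 l *: hs l x.
have [zD zj] := in_D_jet_sum ab alpha01 beta01 (index_enum _) (fun l => c 0 l) ythD hsD.
have jz x : x \in `[a, b] -> jet z x = Z t c x.
  move=> xab; apply: etrans (zj x xab) _; congr (_ + _).
  exact: (jet_ZD ab alpha01 beta01 t yD hD xab).
have Z00 : forall x, x \in `[a, b] -> Z 0 0 x = jet y x by move=> x _; exact: curve00.
have F00 M' : lag_integral a b M' (Z 0 0) = functional a b alpha beta gamma M' y.
  by rewrite functionalE; exact: eq_lag_integral.
have Fz M' : lag_integral a b M' (Z t c) = functional a b alpha beta gamma M' z.
  by rewrite functionalE; apply: eq_lag_integral => x xab; rewrite jz.
have zadm : admissible a b alpha beta gamma G ya yb xi z.
  have za : z a = ya.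
    rewrite /z ya_; have [_ -> _] := hA; rewrite scaler0 addr0 big1 ?addr0// => l _.
    by have [_ -> _] := hsA l; rewrite scaler0.
  have zb : z b = yb.
    rewrite /z yb_; have [_ _ ->] := hA; rewrite scaler0 addr0 big1 ?addr0// => l _.
    by have [_ _ ->] := hsA l; rewrite scaler0.
  exact: (And4 zD za zb (fun j => etrans (esym (Fz (G j)))
    (etrans (FE j) (etrans (F00 (G j)) (Gy j))))).
rewrite (F00 L) (Fz L); apply: (ymin z zadm).
apply: le_lt_trans (norm1inf_le ab nK K0 (m := M * (`|t| + `|c|)) _) _.
  move=> x xab.
  have -> : (fun x => z x - y x) = (fun x => z x + (-1) *: y x).
    by apply/funext => u; rewrite scaleN1r.
  rewrite (jet_ZD ab alpha01 beta01 (-1) zD yD xab) scaleN1r jz// -(Z00 x xab).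
  by have := HM 0 t 0 c x xab; rewrite !subr0.
have tc : `|t| + `|c| <= 2 * (delta / (6 * K * M + 1)).
  by rewrite mulr2n mulrDl !mul1r lerD.
have KM : 0 <= 3 * (K * M) by rewrite mulr_ge0// mulr_ge0// ltW.
rewrite mulrA mulrA -(mulrA 3) (le_lt_trans (ler_wpM2l KM tc))//.
rewrite (_ : 3 * (K * M) * (2 * (delta / (6 * K * M + 1))) =
  delta * ((6 * K * M) / (6 * K * M + 1))); last first.
  by field; exact: lt0r_neq0.
by rewrite gtr_pMr// ltr_pdivrMr// mul1r ltrDl.
Qed.

(* With [hs] dual to the [G j], the direction [g - \sum_m var (G m) g *: hs m]
   annihilates all constraints, hence also the variation of [L]. *)
Lemma lagrange_multipliers (h : 'I_r -> R -> V) : (forall l, adm (h l)) ->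
  \rank (\matrix_(k < r, l < r)
    first_variation (functional a b alpha beta gamma (G k)) y (h l)) = r ->
  exists lam : 'I_r -> R, forall g, adm g ->
    var L g - \sum_(j < r) lam j * var (G j) g = 0.
Proof.
move=> hA; set A := \matrix_(_, _) _ => rA.
have hD l : D (h l) by case: (hA l).
have AE k l : A k l = var (G k) (h l).
  by rewrite mxE; exact: (first_variationE ab alpha01 beta01 (cG k) yD (hD l)).
have uA : A \in unitmx by rewrite -row_free_unit /row_free rA.
have adm0 := admissible_direction0 ab alpha01 beta01 yD.
have [D0 _ _] := adm0.
(* The coefficients are the [m]-th column of the inverse of [A], so the variation of [G j] along
   [hs m] is the (j, m) entry of A A^-1. The zero function is the base term required by the
   summation lemmas. *)
pose hs m x := (fun=> 0 : V) x + \sum_(l < r) invmx A l m *: h l x.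
have hsA m : adm (hs m).
  exact: (admissible_direction_sum ab alpha01 beta01 (index_enum _) (fun l => invmx A l m) adm0 hA).
have hsD m : D (hs m) by case: (hsA m).
have Ghs j m : var (G j) (hs m) = (j == m)%:R.
  have := dlag_integral_jet_sum ab alpha01 beta01 (index_enum _) (fun l => invmx A l m) (cG j) yD D0 hD.
  move=> E; apply: etrans E _.
  apply: etrans (f_equal2 +%R (dlag_integral_jet0 ab alpha01 beta01 (G j) yD) (erefl _)) _.
  rewrite add0r; transitivity ((A *m invmx A) j m); last by rewrite mulmxV// mxE.
  rewrite [RHS]mxE; apply: eq_bigr => l _; rewrite [RHS]mulrC.
  by apply: (f_equal2 *%R (erefl _)); exact: (esym (AE j l)).
(* These multipliers are read off by expanding the variation of [L] along the corrected direction: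
   each [hs m] enters with coefficient minus the variation of [G m] along [g]. *)
exists (fun m => var L (hs m)) => g gA; have gD : D g by case: gA.
pose c m := - var (G m) g.
pose g' x := g x + \sum_(m < r) c m *: hs m x.
have g'A : adm g' := admissible_direction_sum ab alpha01 beta01 (index_enum _) c gA hsA.
have varg' M : C1_in_uvw a b M ->
    var M g' = var M g + \sum_(m < r) c m * var M (hs m).
  move=> cM; exact: (dlag_integral_jet_sum ab alpha01 beta01 (index_enum _) c cM yD gD hsD).
have Gg' j : var (G j) g' = 0.
  apply: etrans (varg' _ (cG j)) _.
  exact: (sum_delta_sub (fun m => var (G m) g) (Ghs j)).
apply: etrans _ (variation_eq0 g'A hsA Gg' Ghs).
apply: etrans _ (esym (varg' L cL)); apply: (f_equal2 +%R (erefl _)).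
exact: (sum_mulN (fun m => var L (hs m)) (fun m => var (G m) g)).
Qed.

End multipliers.

Lemma is_derive_lincomb (R : realType) (U : normedModType R) (I : Type) (s : seq I)
    (u d : U) (lam : I -> R) (f : U -> R) (g : I -> U -> R) :
  derivable f u d -> (forall j, derivable (g j) u d) ->
  is_derive u d (fun w => f w - \sum_(j <- s) lam j * g j w)
    ('D_d f u - \sum_(j <- s) lam j * 'D_d (g j) u).
Proof.
move=> df dg; elim: s => [|j s IH].
  rewrite big_nil subr0 (_ : (fun w => _) = f); first by split.
  by apply/funext => w; rewrite big_nil subr0.
rewrite (_ : (fun w => _) =
    (fun w => (f w - \sum_(j <- s) lam j * g j w) + (- lam j) * g j w)); last first.
  by apply/funext => w; rewrite big_cons; ring.
rewrite (_ : _ - _ = ('D_d f u - \sum_(j <- s) lam j * 'D_d (g j) u) +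
    (- lam j) * 'D_d (g j) u); last by rewrite big_cons; ring.
have dgj : is_derive u d (g j) ('D_d (g j) u) by split.
exact: is_deriveD IH (is_deriveZ (- lam j) dgj).
Qed.

(** * From vanishing variations to the equations *)

Section euler_lagrange.
Context {R : realType} (a b : R) (N r : nat) (alpha beta gamma : R).
Local Notation V := 'rV[R]_N.
Local Notation leb := (@lebesgue_measure R).
Variables (L : lagrangian R N) (G : 'I_r -> lagrangian R N) (lam : 'I_r -> R).
Variable y : R -> V.
Hypothesis ab : a < b.
Hypothesis alpha01 : 0 < alpha < 1.
Hypothesis beta01 : 0 < beta < 1.
Hypothesis cL : C1_in_uvw a b L.
Hypothesis cG : forall j, C1_in_uvw a b (G j).
Hypothesis yD : in_D a b alpha beta gamma y.
Local Notation jet := (jet a b alpha beta gamma).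
Local Notation adm := (admissible_direction a b alpha beta gamma).
Local Notation var M h := (dlag_integral a b M (jet y) (jet h)).
Hypothesis var0 : forall g, adm g ->
  var L g - \sum_(j < r) lam j * var (G j) g = 0.
Local Notation F := (augmented L G lam).

Let alpha01' : 0 < 1 - alpha < 1.
Proof. by case/andP: alpha01 => *; apply/andP; split; lra. Qed.
Let beta01' : 0 < 1 - beta < 1.
Proof. by case/andP: beta01 => *; apply/andP; split; lra. Qed.

(** The termwise partial derivative of the augmented Lagrangian along [y]. Keeping [part] abstract
    treats the derivatives in [u], [v] and [w] at once. *)
Definition aug_along (part : lagrangian R N -> lagrangian R N) (x : R) : R :=
  lag (part L) x (jet y x) - \sum_(j < r) lam j * lag (part (G j)) x (jet y x).

Lemma along_partial_augmented k x : x \in `[a, b] -> [/\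
  along a b alpha beta gamma (partial_u k F) y x = aug_along (partial_u k) x,
  along a b alpha beta gamma (partial_v k F) y x = aug_along (partial_v k) x &
  along a b alpha beta gamma (partial_w k F) y x = aug_along (partial_w k) x].
Proof.
move=> xab; have [_ dL _] := cL.
have dG j : _ := let: And3 _ h _ := cG j in h.
by split; apply: derive_val;
  apply: (@is_derive_lincomb _ _ _ (index_enum _)) => [|j];
  have [? ? ?] := dL x (y x) (derive_on a b y x) (caputo_comb a b alpha beta gamma y x) xab k;
  try (have [? ? ?] := dG j x (y x) (derive_on a b y x) (caputo_comb a b alpha beta gamma y x) xab k).
Qed.

Lemma aug_along_continuous part : (forall M : lagrangian R N, C1_in_uvw a b M ->
    continuous_lagrangian a b (part M)) ->
  {within `[a, b], continuous (aug_along part)}.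
Proof.
move=> cp; have cY := jet_continuous yD.
apply: within_continuous_sub; first exact: (lag_curve_continuous (cp _ cL) cY).
apply: within_continuous_sum => j; apply: within_continuous_scale.
exact: (lag_curve_continuous (cp _ (cG j)) cY).
Qed.

Lemma cont_Rintegral_lincomb (f : R -> R) (g : 'I_r -> R -> R) :
  {within `[a, b], continuous f} -> (forall j, {within `[a, b], continuous (g j)}) ->
  \int[leb]_(x in `[a, b]) (f x - \sum_(j < r) lam j * g j x) =
  \int[leb]_(x in `[a, b]) f x - \sum_(j < r) lam j * \int[leb]_(x in `[a, b]) g j x.
Proof.
move=> cf cg.
have cs j : {within `[a, b], continuous (fun x => lam j * g j x)} := within_continuous_scale (cg j).
rewrite (cont_RintegralB cf (@within_continuous_sum _ a b _ (index_enum _) _ cs)).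
rewrite (@cont_Rintegral_sum _ a b _ (index_enum _) _ cs); congr (_ - _).
by apply: eq_bigr => j _; rewrite cont_RintegralZ.
Qed.

Lemma dlag_delta (M : lagrangian R N) x p (s t u : R) k :
  dlag M x p (s *: delta_mx 0 k, t *: delta_mx 0 k, u *: delta_mx 0 k) =
  lag (partial_u k M) x p * s + lag (partial_v k M) x p * t + lag (partial_w k M) x p * u.
Proof.
have E (f : 'I_N -> R) (c : R) : \sum_(j < N) f j * (c *: delta_mx 0 k : V) 0 j = f k * c.
  rewrite (bigD1 k)//= big1 ?addr0 ?mxE ?eqxx/= ?mulr1// => j jk.
  by rewrite !mxE eqxx (negbTE jk) !mulr0.
by rewrite /dlag !E.
Qed.

Lemma aug_weak_equation k (phi : R -> R) : continuous phi -> primitive a phi b = 0 ->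
  \int[leb]_(t in `[a, b]) (aug_along (partial_u k) t * primitive a phi t +
    aug_along (partial_v k) t * phi t +
    aug_along (partial_w k) t * rl_comb a b alpha beta gamma phi t) = 0.
Proof.
move=> cphi phib.
pose g x : V := primitive a phi x *: delta_mx 0 k.
have gD : in_D a b alpha beta gamma g := primitive_in_D gamma ab alpha01 beta01 k cphi.
have gA : adm g.
  by split; rewrite ?/g ?primitive_a ?phib ?scale0r//; exact: gD.
have cY := jet_continuous yD; have cg := jet_continuous gD.
rewrite -(var0 gA).
rewrite -(cont_Rintegral_lincomb (dlag_curve_continuous cL cY cg)
  (fun j => dlag_curve_continuous (cG j) cY cg)).
apply: eq_Rintegral => x; rewrite inE => xab.
have -> : jet g x = (primitive a phi x *: delta_mx 0 k, phi x *: delta_mx 0 k,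
   rl_comb a b alpha beta gamma phi x *: delta_mx 0 k) :> V * V * V.
  exact: (jet_primitive gamma ab alpha01 beta01 k cphi xab).
rewrite dlag_delta; under [X in _ - X]eq_bigr do rewrite dlag_delta.
rewrite /aug_along !mulrBl !mulr_suml !addrA; move: (primitive a phi x) => s.
rewrite (_ : \sum_(j < r) lam j * _ = \sum_(j < r) lam j * lag (partial_u k (G j)) x (jet y x) * s +
  \sum_(j < r) lam j * lag (partial_v k (G j)) x (jet y x) * phi x +
  \sum_(j < r) lam j * lag (partial_w k (G j)) x (jet y x) * rl_comb a b alpha beta gamma phi x).
  ring.
by rewrite -!big_split; apply: eq_bigr => j _ /=; ring.
Qed.

Lemma EL_momentumE k x : x \in `[a, b] ->
  aug_along (partial_v k) x + rl_comb_adjoint a b alpha beta gamma (aug_along (partial_w k)) x =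
  EL_momentum a b alpha beta gamma F y k x.
Proof.
move=> xab; have [_ Ev _] := along_partial_augmented k xab.
rewrite /EL_momentum Ev /rl_comb_adjoint.
have Ew t : t \in `[a, b] -> along a b alpha beta gamma (partial_w k F) y t = aug_along (partial_w k) t.
  by move=> tab; have [] := along_partial_augmented k tab.
rewrite (eq_RLI_left ab beta01' xab Ew) (eq_RLI_right ab alpha01' xab Ew); ring.
Qed.

Lemma EL_momentum_derive k x : x \in `[a, b] ->
  is_derive_on a b (EL_momentum a b alpha beta gamma F y k) x
    (along a b alpha beta gamma (partial_u k F) y x).
Proof.
move=> xab; apply: (eq_is_derive_on xab (EL_momentumE k)).
have [-> _ _] := along_partial_augmented k xab.
apply: (fractional_du_bois_reymond ab alpha01 beta01) xab.
- by apply: aug_along_continuous => M [_ _ /(_ k)[]].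
- by apply: aug_along_continuous => M [_ _ /(_ k)[]].
- by apply: aug_along_continuous => M [_ _ /(_ k)[]].
- exact: aug_weak_equation.
Qed.

(** Sign bookkeeping: the momentum carries the weights 1 - g and g, while [RLD_comb] receives 1 - g
    as its own weight and [RLD_right] brings its own minus sign. *)
Let momentum_identity (q A B p g : R) :
  q - (1 - g) * A + g * B = p -> p - q + ((1 - g) * A + (1 - (1 - g)) * - B) = 0.
Proof. by move=> <-; ring. Qed.

Lemma EL_equation_holds k x : x \in `[a, b] ->
  EL_equation a b alpha beta gamma F y k x.
Proof.
move=> xab; split; first exact: EL_momentum_derive.
have H := @EL_momentum_derive k x xab.
rewrite /EL_terms_exist /EL_expr /RLD_comb /RLD_left /RLD_right.
set Q := along _ _ _ _ _ (partial_v k F) y; set T := along _ _ _ _ _ (partial_w k F) y.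
set P := along _ _ _ _ _ (partial_u k F) y.
move=> [dQ dl dr].
(* With coefficient 0 the product is the zero function, whose derivative is 0 whatever value
   [derive_on] takes on [f]. This matches the conditional clauses of [EL_terms_exist]. *)
have scaled (c : R) (f : R -> R) : (c != 0 -> derivable_on a b f x) ->
    is_derive_on a b (fun t => c * f t) x (c * derive_on a b f x).
  have D0 : is_derive_on a b (fun=> 0 : R) x 0.
    by apply: is_derive_on_is_derive; exact: is_derive_cst.
  have [->|c0] := eqVneq c 0.
    by rewrite mul0r => _; apply: eq_is_derive_on D0 => // t _; rewrite mul0r.
  move=> /(_ isT) df.
  have := is_derive_onZD (c := c) D0 (derivable_on_is_derive df); rewrite add0r.
  by apply: eq_is_derive_on => // t _; rewrite add0r.
have D1 : is_derive_on a b (fun t => (1 - gamma) * RLI_left a (1 - beta) T t) x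
    ((1 - gamma) * derive_on a b (RLI_left a (1 - beta) T) x).
  apply: scaled => g1; apply: dl; apply: contra_neq g1 => ->; by rewrite subrr.
have D2 : is_derive_on a b (fun t => gamma * RLI_right b (1 - alpha) T t) x
    (gamma * derive_on a b (RLI_right b (1 - alpha) T) x).
  exact: scaled.
have D3 := is_derive_onZD (c := 1)
  (is_derive_onZD (c := -1) (derivable_on_is_derive dQ) D1) D2.
have {}D3 : is_derive_on a b (EL_momentum a b alpha beta gamma F y k) x
  (derive_on a b Q x + -1 *: ((1 - gamma) * derive_on a b (RLI_left a (1 - beta) T) x) +
   1 *: (gamma * derive_on a b (RLI_right b (1 - alpha) T) x)).
  apply: eq_is_derive_on D3 => // t _.
  by rewrite /EL_momentum scaleN1r scale1r.
(* The momentum now has two derivatives at [x], the sum of the separate ones and d_uF; uniqueness of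
   the limit equates them. *)
have := etrans (esym (is_derive_on_lim ab xab D3)) (is_derive_on_lim ab xab H).
rewrite scaleN1r scale1r => E.
exact: momentum_identity E.
Qed.

End euler_lagrange.

Theorem theorem18 (R : realType) (a b : R) (N r : nat) (alpha beta gamma : R)
    (nrm : 'rV[R]_N -> R) (L : lagrangian R N) (G : 'I_r -> lagrangian R N)
    (ya yb : 'rV[R]_N) (xi : 'I_r -> R) (y : R -> 'rV[R]_N)
    (ltab : a < b)
    (alpha01 : 0 < alpha < 1) (beta01 : 0 < beta < 1)
    (gamma01 : 0 <= gamma <= 1)
    (nrm_norm : is_norm nrm)
    (L_C1 : C1_lagrangian a b L)
    (G_C1 : forall j, C1_lagrangian a b (G j))
    (y_min : local_minimizer a b alpha beta gamma nrm L G ya yb xi y)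
    (J_var : continuous_variations_near a b alpha beta gamma nrm L y)
    (G_var : forall j,
       continuous_variations_near a b alpha beta gamma nrm (G j) y)
    (full_rank : exists h : 'I_r -> R -> 'rV[R]_N,
       (forall l, admissible_direction a b alpha beta gamma (h l)) /\
       \rank (\matrix_(k < r, l < r)
          first_variation (functional a b alpha beta gamma (G k)) y (h l)) = r) :
  exists lam : 'I_r -> R,
    forall (k : 'I_N) (x : R), x \in `[a, b] ->
      EL_equation a b alpha beta gamma (augmented L G lam) y k x.
Proof.
have cL := C1_lagrangian_uvw L_C1.
have cG j := C1_lagrangian_uvw (G_C1 j).
have [h [hA rk]] := full_rank.
have [lam Hlam] := lagrange_multipliers ltab alpha01 beta01 nrm_norm cL cG y_min hA rk.
have yD : in_D a b alpha beta gamma y by case: y_min => [[]].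
by exists lam => k x; exact: EL_equation_holds.
Qed.
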